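(* Let $p\ge 2$, $\alpha=p-1$ and $\theta\ge 0$. There exist positive constants $c(\alpha,\theta)$ and $C(\alpha,\theta)$, depending only on $\alpha$ and $\theta$, such that for all $\mu<\mu_{\alpha,\theta}$ close enough to $\mu_{\alpha,\theta}$, $$\frac{c(\alpha,\theta)}{1-\left(\frac{\mu}{\mu_{\alpha,\theta}}\right)^{p-1}}\le TMSC(\mu,\alpha,\theta)\le \frac{C(\alpha,\theta)}{1-\left(\frac{\mu}{\mu_{\alpha,\theta}}\right)^{p-1}}.$$ Moreover, the constant $\mu_{\alpha,\theta}$ is sharp in the sense that $TMSC(\mu_{\alpha,\theta},\alpha,\theta)=\infty$.
   Context: For real $\theta\ge 0$ let $\omega_\theta=\frac{2\pi^{(\theta+1)/2}}{\Gamma((\theta+1)/2)}$ and $\int_0^\infty f(r)\,\mathrm{d}\lambda_\theta=\omega_\theta\int_0^\infty f(r)r^\theta\,\mathrm{d}r$. For $1\le q<\infty$, $L^q_\theta$ is the space of measurable $u$ on $(0,\infty)$ with $\|u\|_{L^q_\theta}=\left(\int_0^\infty |u|^q\,\mathrm{d}\lambda_\theta\right)^{1/q}<\infty$ (similarly with $\alpha$ in place of $\theta$). $X^{1,p}_\infty=X^{1,p}_\infty(\alpha,\theta)$ is the set of all locally absolutely continuous functions $u$ on $(0,\infty)$ with $\lim_{r\to\infty}u(r)=0$, $u\in L^p_\theta$ and $u'\in L^p_\alpha$. $\mu_{\alpha,\theta}=(\theta+1)\omega_\alpha^{1/\alpha}$. For $t\ge 0$, $\varphi_p(t)=\sum_{j\in\mathbb{N},\,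 j\ge p-1}\frac{t^j}{j!}$. For $0\le\mu\le\mu_{\alpha,\theta}$, $$TMSC(\mu,\alpha,\theta)=\sup\left\{\frac{1}{\|u\|^p_{L^p_\theta}}\int_0^\infty\varphi_p\left(\mu|u|^{\frac{p}{p-1}}\right)\mathrm{d}\lambda_\theta \;:\; u\in X^{1,p}_\infty(\alpha,\theta)\setminus\{0\},\ \|u'\|_{L^p_\alpha}\le 1\right\}\in[0,\infty].$$ *)

(* Defs.v *)
From HB Require Import structures.
From mathcomp Require Export all_boot all_order all_algebra.
From mathcomp Require Export all_classical all_reals all_analysis.
Export numFieldNormedType.Exports.

Set Implicit Arguments.
Unset Strict Implicit.
Unset Printing Implicit Defensive.

Import Order.TTheory GRing.Theory Num.Theory.
Local Open Scope classical_set_scope.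
Local Open Scope ring_scope.

Section TrudingerMoser.
Context {R : realType}.
Implicit Types (p q x a b t theta alpha mu : R) (u v : R -> R).

Definition Gamma x : R :=
  \int[lebesgue_measure]_(t in `]0, +oo[) (t `^ (x - 1) * expR (- t)).

Definition omega theta : R :=
  2 * pi `^ ((theta + 1) / 2) / Gamma ((theta + 1) / 2).

(* Integral over (0, oo) against d lambda_theta = omega_theta r^theta dr. *)
Definition lambda_integral theta (f : R -> \bar R) : \bar R :=
  ((omega theta)%:E *
   \int[lebesgue_measure]_(r in `]0%R, +oo[) (f r * (r `^ theta)%:E))%E.

(* Functions on (0, oo) are represented by functions on R whose values on
   (-oo, 0] are irrelevant: every notion below only looks at (0, oo).
   Measurable means Borel; for the members of X1p and their derivatives this
   loses nothing, see below. *)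

Definition Lqnorm theta q u : \bar R :=
  (lambda_integral theta (fun r => (`|u r| `^ q)%:E) `^ q^-1)%E.

Definition Lq theta q : set (R -> R) :=
  [set u | measurable_fun (`]0, +oo[ : set R) u /\ (Lqnorm theta q u < +oo)%E].

(* Degenerate intervals x i = y i are allowed, they do not contribute. *)
Definition absolutely_continuous_on a b u : Prop :=
  forall eps, 0 < eps -> exists2 delta, 0 < delta &
    forall (n : nat) (x y : 'I_n -> R),
      (forall i, a <= x i /\ x i <= y i /\ y i <= b) ->
      trivIset [set: 'I_n] (fun i => `]x i, y i[%classic) ->
      \sum_(i < n) (y i - x i) < delta ->
      \sum_(i < n) `|u (y i) - u (x i)| < eps.

Definition locally_absolutely_continuous u : Prop :=
  forall a b, 0 < a -> a <= b -> absolutely_continuous_on a b u.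

(* A locally absolutely continuous u is derivable almost everywhere on
   (0, oo); u^`() takes a fixed default value on the Borel null set where u is
   not derivable, hence it is a Borel representative of the a.e. derivative. *)
Definition X1p p alpha theta : set (R -> R) :=
  [set u | [/\ locally_absolutely_continuous u,
               u r @[r --> +oo] --> 0,
               Lq theta p u &
               Lq alpha p (u^`()%classic)]].

Definition mu_crit alpha theta : R :=
  (theta + 1) * omega alpha `^ alpha^-1.

Definition phi p t : \bar R :=
  (\sum_(0 <= j <oo | (p - 1 <= j%:R)%R) (t ^+ j / j`!%:R)%:E)%E.

(* The order p, usually left implicit (p = alpha + 1), is the first argument.
   u != 0 means that u is not identically zero on (0, oo); since u is
   continuous there, the L^p_theta norm below is then positive and finite. *)
Definition TMSC p mu alpha theta : \bar R :=
  ereal_sup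
    [set (lambda_integral theta (fun r => phi p (mu * `|u r| `^ (p / (p - 1))))
          / (Lqnorm theta p u `^ p))%E
    | u in [set u | [/\ X1p p alpha theta u,
                        exists2 r, 0 < r & u r != 0 &
                        (Lqnorm alpha p (u^`()%classic) <= 1)%E]]].

End TrudingerMoser.

(* Main.v *)
From HB Require Import structures.
Require Import Defs.
From mathcomp Require Import ring lra measurable_realfun.

Set Implicit Arguments.
Unset Strict Implicit.
Unset Printing Implicit Defensive.

Import Order.TTheory GRing.Theory Num.Theory.
Local Open Scope classical_set_scope.
Local Open Scope ring_scope.

(* Write N = theta + 1, q = p / (p - 1), k = mu / mu_crit, d = 1 - k^(p - 1), and
   v = mu^(1/q) |u|, so that v^q = mu |u|^q and v^p = mu^(p - 1) |u|^p. In the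
   logarithmic variable t = - N ln r, Hoelder's inequality bounds |v(r) - v(s)|^p
   by k^(p - 1) times the energy of u between r and s times |t(r) - t(s)|^(p - 1).
   That the increments of u are bounded by the integral of |u'| follows from writing
   u as a difference of absolutely continuous nondecreasing functions, by means of
   its total variation: their Stieltjes measures have Radon-Nikodym densities, which
   are their derivatives almost everywhere by Lebesgue's differentiation theorem.

   Upper bound. Let m be the integral of v^p r^theta and choose R0 with
   R0^N = 2 m / d. By averaging, v^p <= d at some r0 in [R0, 2 R0], and beyond R0
   the function v is bounded by a constant, so that phi_p(v^q) is at most a
   constant times v^p there. Below r0, convexity of x^q with weights 1 - d and d
   gives v^q <= 1 + z^q, where z = k^(-1/q) |v - v(r0)| vanishes at r0 and
   satisfies the increment bound with constant 1 instead of k^(p - 1). Moser's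
   critical inequality then bounds the integral of exp(z^q) r^theta over (0, r0)
   by a multiple of r0^N, that is, of m / d.

   Moser's inequality follows from an estimate of the level sets
   {t - z^q <= s}: if t1 belongs to the level set and is at least a large multiple
   of s, then at most (p - 1) s / t1 of the energy is left beyond t1, and this
   forces any other point t2 of the level set to satisfy t2 - t1 <= C s.

   Lower bound. Moser's functions A min(L, max(0, - N ln r)) with L = 1 / (1 - k).
   They also show that the supremum is infinite at mu_crit, by monotonicity in mu. *)

(** * Absolutely continuous functions *)

Section absolute_continuity.
Context {R : realType}.
Implicit Types (a b x y : R) (f g : R -> R) (l m : seq (R * R)).
Local Notation mu := (@lebesgue_measure R).

Definition nonoverlapping (i j : R * R) := (i.2 <= j.1) || (j.2 <= i.1).

Definition nonoverlapping_in a b l :=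
  all (fun i => (a <= i.1) && (i.1 <= i.2) && (i.2 <= b)) l && pairwise nonoverlapping l.

Definition length_sum l : R := \sum_(i <- l) (i.2 - i.1).

Definition increment_sum f l : R := \sum_(i <- l) `|f i.2 - f i.1|.

(* Finite families as lists instead of 'I_n-indexed pairs: lists are easily
   refined and concatenated. *)
Definition list_ac a b f := forall e, 0 < e -> exists2 d, 0 < d &
  forall l, nonoverlapping_in a b l -> length_sum l < d -> increment_sum f l < e.

Lemma nonoverlapping_sym : symmetric nonoverlapping.
Proof. by move=> i j; rewrite /nonoverlapping orbC. Qed.

Lemma list_ac_absolutely_continuous a b f :
  absolutely_continuous_on a b f -> list_ac a b f.
Proof.
move=> acf e e0; have [d d0 H] := acf e e0; exists d => // l /andP[/allP lab sl] ld.
pose x (i : 'I_(size l)) := (nth (0, 0) l i).1.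
pose y (i : 'I_(size l)) := (nth (0, 0) l i).2.
have := H (size l) x y.
rewrite /increment_sum /length_sum in ld *.
rewrite (big_nth (0, 0)) big_mkord in ld; rewrite (big_nth (0, 0)) big_mkord.
apply => //.
- move=> i; have /lab /andP[/andP[-> ->] ->] // : nth (0, 0) l i \in l.
  by rewrite mem_nth.
- apply/trivIsetP => i j _ _ ij.
  wlog lij : i j ij / (i < j)%N.
    move=> W; have [|] := ltnP i j; first exact: W.
    rewrite leq_eqVlt => /orP[/eqP/val_inj ji|]; first by rewrite ji eqxx in ij.
    by rewrite setIC; apply: W; rewrite eq_sym.
  apply/seteqP; split => // r [] /=; rewrite !in_itv/= => /andP[xr ry] /andP[xr' ry'].
  move/(pairwiseP (0, 0)) : sl => /(_ i j); rewrite !inE !ltn_ord => /(_ erefl erefl lij).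
  by move=> /orP[] h; [have := lt_trans xr' (lt_le_trans ry h)|
     have := lt_trans xr (lt_le_trans ry' h)]; rewrite ltxx.
Qed.

Lemma nonoverlapping_in_cat a b l m : nonoverlapping_in a b (l ++ m) =
  [&& nonoverlapping_in a b l, nonoverlapping_in a b m & allrel nonoverlapping l m].
Proof.
rewrite /nonoverlapping_in all_cat pairwise_cat.
by do !case: (all _ _); do !case: (pairwise _ _); rewrite ?andbT ?andbF.
Qed.

(** Each point of [s] is zipped with its predecessor and the pair is swapped, left endpoint first;
    [zip] cuts off the last point of [x :: s]. *)
Definition partition_list x s := [seq (i.2, i.1) | i <- zip s (x :: s)].

Lemma variation_partition_list x y f s : itv_partition x y s ->
  variation x y f s = increment_sum f (partition_list x s).
Proof. by move=> h; rewrite variation_zip// /increment_sum big_map. Qed.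

Lemma partition_list_cons x z s :
  partition_list x (z :: s) = (x, z) :: partition_list z s.
Proof. by rewrite /partition_list. Qed.

Lemma partition_list_bounds x y s : itv_partition x y s ->
  forall i, i \in partition_list x s -> [/\ x <= i.1, i.1 <= i.2 & i.2 <= y].
Proof.
elim: s x => [|z s ih] x h i; first by rewrite /partition_list/= inE.
have zy := itv_partition_cons h.
have xz : x <= z by case: h => /= /andP[/ltW].
rewrite partition_list_cons inE => /orP[/eqP ->/=|iz].
  by split => //; exact: itv_partition_le zy.
have [zi i12 iy] := ih _ zy _ iz.
by split => //; exact: le_trans zi.
Qed.

Lemma partition_list_nonoverlapping x y s : itv_partition x y s ->
  pairwise nonoverlapping (partition_list x s).
Proof.
elim: s x => [//|z s ih] x h; have zy := itv_partition_cons h.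
rewrite partition_list_cons pairwise_cons (ih _ zy) andbT.
apply/allP => i /(partition_list_bounds zy)[zi _ _].
by rewrite /nonoverlapping zi.
Qed.

Lemma partition_list_length x y s : itv_partition x y s ->
  length_sum (partition_list x s) = y - x.
Proof.
elim: s x => [|z s ih] x h.
  by rewrite /length_sum big_nil (itv_partition_nil h) subrr.
rewrite partition_list_cons /length_sum big_cons -/(length_sum _).
by rewrite (ih _ (itv_partition_cons h))/=; lra.
Qed.

Lemma increment_sum_ge0 f l : 0 <= increment_sum f l.
Proof. exact: sumr_ge0. Qed.

Lemma length_sum_cat l m : length_sum (l ++ m) = length_sum l + length_sum m.
Proof. by rewrite /length_sum big_cat. Qed.

Lemma nonoverlapping_in_refine a b x y s l :
  itv_partition x y s -> nonoverlapping_in a b ((x, y) :: l) ->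
  nonoverlapping_in a b (partition_list x s ++ l).
Proof.
move=> h; rewrite /nonoverlapping_in/= => /andP[/andP[/andP[/andP[ax xy] yb] al] /andP[sx sl]].
rewrite all_cat al pairwise_cat sl (partition_list_nonoverlapping h) !andbT.
apply/andP; split.
  apply/allP => i /(partition_list_bounds h)[xi -> iy].
  by rewrite (le_trans ax xi) (le_trans iy yb).
apply/allrelP => i j /(partition_list_bounds h)[xi i12 iy] jl.
have /allP /(_ _ jl) := sx.
rewrite /nonoverlapping /= => /orP[yj|jx].
  by rewrite (le_trans iy yj).
by rewrite (le_trans jx xi) orbT.
Qed.

Lemma nonoverlapping_in_catC a b l m :
  nonoverlapping_in a b (l ++ m) = nonoverlapping_in a b (m ++ l).
Proof.
rewrite !nonoverlapping_in_cat andbCA; congr [&& _, _ & _].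
by rewrite allrelC; apply: eq_allrel => i j; exact: nonoverlapping_sym.
Qed.

Lemma nonoverlapping_in_drop a b i l : nonoverlapping_in a b (i :: l) -> nonoverlapping_in a b l.
Proof. by rewrite /nonoverlapping_in/= => /andP[/andP[_ ->] /andP[_ ->]]. Qed.

Local Notation TV := (@total_variation R).

(** Induction on [l]: any partition of its first interval moves into the already subdivided part
    [m], which changes neither the total length nor the separation. The supremum over these
    partitions replaces increments by the variation. *)
Lemma total_variation_sum_le a b f d e : 0 < e ->
  (forall l, nonoverlapping_in a b l -> length_sum l < d -> increment_sum f l < e) ->
  forall l m, nonoverlapping_in a b (l ++ m) -> length_sum (l ++ m) < d ->
  (\sum_(i <- l) TV i.1 i.2 f + (increment_sum f m)%:E <= e%:E)%E.
Proof.
move=> e0 H; elim=> [|[x y] l ih] m sm lm.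
  by rewrite big_nil add0e lee_fin ltW// H.
have xy : x <= y by move: sm => /andP[/= /andP[/andP[/andP[]]]].
rewrite big_cons/= -addeA addeC.
have dm := nonoverlapping_in_drop sm.
have Sge0 : (0 <= \sum_(i <- l) TV i.1 i.2 f)%E.
  rewrite big_seq sume_ge0// => i il; apply: total_variation_ge0.
  move: dm => /andP[/allP/(_ i)]; rewrite mem_cat il => /(_ erefl).
  by move=> /andP[/andP[]].
have Ile : (\sum_(i <- l) TV i.1 i.2 f + (increment_sum f m)%:E <= e%:E)%E.
  apply: ih => //; apply: le_lt_trans lm.
  by rewrite /length_sum/= big_cons lerDr subr_ge0.
(* Finite terms can be moved across the inequality, which leaves the variation of the head alone, to
   be bounded as a supremum. *)
have Ifin : (\sum_(i <- l) TV i.1 i.2 f + (increment_sum f m)%:E)%E \is a fin_num.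
  rewrite ge0_fin_numE ?adde_ge0 ?lee_fin ?increment_sum_ge0//.
  by rewrite (le_lt_trans Ile)// ltry.
rewrite -leeBrDl//; apply: ge_ereal_sup => _ [_ [s xys <-] <-].
rewrite leeBrDl// -addeA -EFinD (variation_partition_list f xys).
rewrite /increment_sum -big_cat/=; apply: ih.
  by rewrite catA nonoverlapping_in_catC; exact: (nonoverlapping_in_refine xys sm).
apply: le_lt_trans lm; rewrite !length_sum_cat (partition_list_length xys).
by rewrite /length_sum/= big_cons/=; lra.
Qed.

(** With the [d] that belongs to 1, the variation over an interval of length at most d / 2 is at
    most 1, and finitely many such intervals cover [a, b]. *)
Lemma list_ac_total_variation_lty a b f : a <= b -> list_ac a b f ->
  (TV a b f < +oo)%E.
Proof.
move=> ab /(_ 1 ltr01)[d d0 H].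
have K n : forall x, a <= x -> x <= b -> x <= a + d / 2 * n%:R -> (TV a x f < +oo)%E.
  elim: n => [|n ih] x ax xb.
    rewrite mulr0 addr0 => xa; have -> : x = a by apply/eqP; rewrite eq_le xa.
    by rewrite total_variationxx.
  move=> xn; have [|nx] := leP x (a + d / 2 * n%:R); first exact: ih.
  have ay : a <= a + d / 2 * n%:R by rewrite lerDl mulr_ge0// ltW// divr_gt0.
  rewrite (total_variationD f ay (ltW nx)) lte_add_pinfty//.
    by apply: ih => //; rewrite (le_trans (ltW nx)).
  have := @total_variation_sum_le a b f d 1 ltr01 H [:: (a + d / 2 * n%:R, x)] [::].
  rewrite big_seq1 /increment_sum big_nil adde0/= => h.
  apply: (@le_lt_trans _ _ 1%:E); last exact: ltry.
  apply: h; first by rewrite /nonoverlapping_in/= ay (ltW nx) xb.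
  rewrite /length_sum big_seq1/=.
  by move: xn; rewrite -(natr1 n) mulrDr mulr1; lra.
have [n hn] : exists n, (b - a) / (d / 2) <= n%:R :> R.
  exists (Num.bound ((b - a) / (d / 2))).
  by rewrite ltW// archi_boundP// divr_ge0 ?subr_ge0// ltW// divr_gt0.
apply: (K n) => //; rewrite -lerBlDl mulrC -ler_pdivrMr ?divr_gt0//.
Qed.

Lemma list_ac_continuous a b f e : list_ac a b f -> 0 < e ->
  exists2 d, 0 < d & forall x y, a <= x -> x <= y -> y <= b -> y - x < d ->
    `|f y - f x| < e.
Proof.
move=> acf e0; have [d d0 H] := acf e e0; exists d => // x y ax xy yb yxd.
have := H [:: (x, y)]; rewrite /increment_sum /length_sum !big_seq1/=.
by apply => //; rewrite /nonoverlapping_in/= ax xy yb.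
Qed.

Definition variation_function a f x : R := fine (TV a x f).

Lemma variation_functionB a b f x y : list_ac a b f -> a <= x -> x <= y -> y <= b ->
  (variation_function a f y - variation_function a f x)%:E = TV x y f.
Proof.
move=> acf ax xy yb.
have yfin : TV a y f \is a fin_num.
  apply/bounded_variationP; first exact: le_trans xy.
  apply: (bounded_variationl (le_trans ax xy) yb).
  have ab : a <= b by rewrite (le_trans ax)// (le_trans xy).
  apply/bounded_variationP => //; rewrite ge0_fin_numE ?total_variation_ge0//.
  exact: list_ac_total_variation_lty.
rewrite /variation_function EFinB fineK//.
move: yfin; rewrite (total_variationD f ax xy) fin_numD => /andP[xfin xyfin].
by rewrite fineK// addeC addeA (addeC (- _)%E) subee// add0e.
Qed.

Lemma list_ac_variation_function a b f : list_ac a b f ->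
  list_ac a b (variation_function a f).
Proof.
move=> acf e e0.
(* Suprema keep only a non-strict bound, hence [e / 2]. *)
have [d d0 H] := acf (e / 2) (divr_gt0 e0 (ltr0n _ 2)).
exists d => // l sl ll; rewrite -lte_fin.
have := @total_variation_sum_le a b f d (e / 2) (divr_gt0 e0 (ltr0n _ 2)) H l [::].
rewrite cats0 /increment_sum big_nil adde0 => /(_ sl ll).
rewrite (_ : \sum_(i <- l) TV i.1 i.2 f = (\sum_(i <- l)
    `|variation_function a f i.2 - variation_function a f i.1|)%:E)%E.
  by move=> h; apply: (le_lt_trans h); rewrite lte_fin; lra.
rewrite -sumEFin big_seq [RHS]big_seq; apply: eq_bigr => i il.
move: sl => /andP[/allP /(_ _ il)/andP[/andP[ai i12] ib] _].
have E := variation_functionB acf ai i12 ib.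
rewrite -E ger0_norm// -lee_fin E; exact: total_variation_ge0.
Qed.

Lemma list_acB a b f g : list_ac a b f -> list_ac a b g -> list_ac a b (f \- g).
Proof.
move=> acf acg e e0; have e2 : 0 < e / 2 by rewrite divr_gt0.
have [d d0 H] := acf _ e2; have [d' d'0 H'] := acg _ e2.
exists (Num.min d d'); first by rewrite lt_min d0.
move=> l sl; rewrite lt_min => /andP[/(H _ sl) hf /(H' _ sl) hg].
rewrite [e]splitr; apply: le_lt_trans (ltrD hf hg).
rewrite /increment_sum -big_split/= ler_sum// => i _.
by rewrite opprD opprK addrACA (le_trans (ler_normD _ _))// lerD2l -normrN opprD opprK.
Qed.

End absolute_continuity.

Section clamp.
Context {R : realType}.
Implicit Types (a b x y : R).

(** Serves twice: to continue a function on [a, b] by constants, and to truncate the logarithm in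
    Moser's functions. *)
Definition clamp a b x : R := Num.min b (Num.max a x).

Lemma clamp_id a b x : a <= x -> x <= b -> clamp a b x = x.
Proof. by move=> ax xb; rewrite /clamp max_r// min_r. Qed.

Lemma clamp_ge a b x : a <= b -> a <= clamp a b x.
Proof. by move=> ab; rewrite /clamp le_min ab le_max lexx. Qed.

Lemma clamp_le a b x : clamp a b x <= b.
Proof. by rewrite /clamp ge_min lexx. Qed.

Lemma clamp_nondecreasing a b x y : x <= y -> clamp a b x <= clamp a b y.
Proof. by move=> xy; rewrite /clamp le_min2// le_max2. Qed.

Lemma clamp_distr a b x y : x <= y -> clamp a b y - clamp a b x <= y - x.
Proof.
rewrite /clamp => xy.
have [h1|h1] := leP a x; have [h2|h2] := leP a y; do ?[lra].
all: have [h3|h3] := leP b y; have [h4|h4] := leP b x; have [h5|h5] := leP b a; lra.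
Qed.

End clamp.

(** * Densities of monotone absolutely continuous functions *)

Section monotone_density.
Context {R : realType}.
Variables (a b : R) (g : R -> R).
Hypotheses (ab : a < b) (ndg : forall x y, a <= x -> x <= y -> y <= b -> g x <= g y).
Hypothesis acg : list_ac a b g.
Local Notation mu := (@lebesgue_measure R).

(** A Stieltjes measure needs a cumulative function on the whole line. *)
Let G x := g (clamp a b x).

Let G_nd : nondecreasing G.
Proof.
move=> x y xy; apply: ndg; [exact/clamp_ge/ltW| |exact: clamp_le].
exact: clamp_nondecreasing.
Qed.

Let G_rc : right_continuous G.
Proof.
move=> x; apply/cvgrPdist_lt => e e0.
have [d d0 H] := list_ac_continuous acg e0.
near=> t; rewrite distrC /G; apply: H.
- exact/clamp_ge/ltW.
- exact: clamp_nondecreasing.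
- exact: clamp_le.
- apply: le_lt_trans (clamp_distr a b _) _ => //.
  by rewrite ltrBlDr addrC; near: t; apply: nbhs_right_lt; rewrite ltrDl.
Unshelve. all: by end_near. Qed.

HB.instance Definition _ := isCumulative.Build R _ R G G_nd G_rc.

Let ls : {measure set (measurableTypeR R) -> \bar R} := lebesgue_stieltjes_measure G.

Let ls_oc x y : x <= y -> ls `]x, y]%classic = (G y - G x)%:E.
Proof.
move=> xy; rewrite /ls/= /lebesgue_stieltjes_measure /measure_extension.
rewrite measurable_mu_extE/=; last exact: is_ocitv.
by rewrite wlength_itv_bnd.
Qed.

Let mab : measurable (`]a, b]%classic : set (measurableTypeR R)).
Proof. exact: measurable_itv. Qed.

Let ls_lty : (ls `]a, b]%classic < +oo)%E.
Proof. by rewrite ls_oc ?ltW// ltry. Qed.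

Let nu : {finite_measure set (measurableTypeR R) -> \bar R} := mfrestr mab ls_lty.

Let nu_oc x : a <= x -> x <= b -> nu `]a, x]%classic = (g x - g a)%:E.
Proof.
move=> ax xb; rewrite /nu/= /mfrestr /mrestr setIidl; last first.
  by move=> z /=; rewrite !in_itv/= => /andP[-> /le_trans ->].
by rewrite [LHS]ls_oc// /G !clamp_id ?lexx// ltW.
Qed.

Let nu_oo x y : x < y -> (nu `]x, y[%classic <= (G y - G x)%:E)%E.
Proof.
move=> xy; rewrite -ls_oc; last exact: ltW; rewrite /nu/= /mfrestr /mrestr.
apply: le_measure; rewrite ?inE.
- by apply: measurableI; [exact: measurable_itv|exact: mab].
- exact: measurable_itv.
- by move=> z []/=; rewrite !in_itv/= => /andP[-> /ltW ->].
Qed.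


(** The components of [U] are countably many disjoint open intervals. Finitely many of them have
    total length less than [d], so their [G]-increments sum to less than [e] by absolute continuity,
    and the bound passes to the limit. Confining [U] to ]a - 1, b + 1[ keeps the components
    bounded. *)
Let nu_open_le (e : R) : 0 < e -> exists2 d, 0 < d &
  forall U : set R, open U -> U `<=` `]a - 1, b + 1[%classic -> (mu U < d%:E)%E ->
    (nu U <= e%:E)%E.
Proof.
move=> e0; have [d d0 H] := acg e0; exists d => // U oU Uab Ud.
pose I := open_disjoint_itv oU.
have UI : U = \bigcup_q I q := open_disjoint_itv_bigcup oU.
have tI : trivIset setT I by exact: open_disjoint_itv_trivIset.
pose x q := inf (I q); pose y q := sup (I q).
have IE q : I q = `]x q, y q[%classic.
  have IU : I q `<=` `]a - 1, b + 1[%classic.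
    by apply: subset_trans Uab; rewrite UI; exact: bigcup_sup.
  have /interior_id {1}<- : open (I q) by exact: open_disjoint_itv_open.
  rewrite interval_bounded_interior; last 3 first.
  - exact: open_disjoint_itv_is_interval.
  - by exists (a - 1) => z /IU /=; rewrite in_itv/= => /andP[/ltW].
  - by exists (b + 1) => z /IU /=; rewrite in_itv/= => /andP[_ /ltW].
  by apply/seteqP; split => z /=; rewrite in_itv.
have mI q : measurable (I q : set (measurableTypeR R)).
  by rewrite IE; exact: measurable_itv.
(* If two nonempty components overlapped, the midpoint of the overlap would lie in both. *)
have sep p q : x p < y p -> x q < y q -> p != q -> (y p <= x q) || (y q <= x p).
  move=> xyp xyq pq; apply/negPn/negP; rewrite negb_or -!ltNge => /andP[h1 h2].
  move/trivIsetP : tI => /(_ p q Logic.I Logic.I pq) /seteqP[+ _].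
  pose lo := Num.max (x p) (x q); pose hi := Num.min (y p) (y q).
  have lohi : lo < hi by rewrite /lo /hi gt_max !lt_min xyp xyq h1 h2.
  move=> /(_ ((lo + hi) / 2)); apply.
  have [m1 m2] := midf_lt lohi.
  by split; rewrite IE /= in_itv/=; apply/andP; split;
    [apply: le_lt_trans m1|apply: lt_le_trans m2 _
    |apply: le_lt_trans m1|apply: lt_le_trans m2 _];
    rewrite /lo /hi ?le_max ?ge_min lexx ?orbT.
have muU : mu U = (\sum_(q <oo) mu (I q))%E.
  by rewrite {1}UI measure_semi_bigcup//; exact: bigcup_measurable.
have nuU : nu U = (\sum_(q <oo) nu (I q))%E.
  by rewrite {1}UI measure_semi_bigcup//; exact: bigcup_measurable.
rewrite nuU; apply: lime_le; first by apply: is_cvg_nneseries => ? _ _; exact: measure_ge0.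
apply: nearW => n /=.
(* The filter drops the empty components. [clamp] brings the others into [a, b] without lengthening
   them or changing their [G]-increments. *)
pose l := [seq (clamp a b (x i), clamp a b (y i)) | i <- index_iota 0 n & x i < y i].
have sl : nonoverlapping_in a b l.
  apply/andP; split.
    apply/allP => i /mapP[q]; rewrite mem_filter => /andP[xyq _] ->/=.
    by rewrite clamp_ge ?clamp_nondecreasing ?clamp_le// ltW.
  rewrite pairwise_map; have : uniq (index_iota 0 n) by exact: iota_uniq.
  elim: (index_iota 0 n) => //= p s ih /andP[ps /ih].
  case: ifPn => // xyp us /=; rewrite us andbT; apply/allP => q.
  rewrite mem_filter => /andP[xyq qs] /=.
  have pq : p != q by apply: contraNneq ps => ->.
  by rewrite /nonoverlapping/=; have /orP[h|h] := sep _ _ xyp xyq pq;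
    rewrite (clamp_nondecreasing _ _ h) ?orbT.
have ll : length_sum l < d.
  rewrite -lte_fin; apply: le_lt_trans Ud; rewrite muU.
  apply: le_trans (nneseries_lim_ge (P := xpredT) n _); last by [].
  rewrite /length_sum big_map big_filter -sumEFin/= big_mkcond/=.
  apply: lee_sum => q _; rewrite IE lebesgue_measure_itv/= lte_fin.
  by case: ifPn => // xyq; rewrite -EFinB lee_fin clamp_distr// ltW.
have /ltW := H l sl ll; rewrite -lee_fin; apply: le_trans.
rewrite /increment_sum big_map big_filter -sumEFin/= [leRHS]big_mkcond/=.
apply: lee_sum => q _; rewrite IE; case: ifPn => xyq.
  by rewrite (le_trans (nu_oo xyq))// lee_fin ler_norm.
have -> : `]x q, y q[%classic = set0 by rewrite set_itv_ge// bnd_simp.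
by rewrite measure0.
Qed.

(** By outer regularity a null set, cut down to ]a, b], lies in open sets of arbitrarily small
    measure, and [nu_open_le] applies to these. *)
Let nu_dominated : nu `<< mu.
Proof.
apply/null_content_dominatesP => A mA A0.
apply/eqP; rewrite eq_le measure_ge0 andbT; apply/lee_addgt0Pr => e e0.
rewrite add0e; have [d d0 H] := nu_open_le e0.
have mAb : measurable (A `&` `]a, b]%classic : set (measurableTypeR R)).
  by apply: measurableI.
have A'0 : mu (A `&` `]a, b]%classic) = 0%E.
  by apply: subset_measure0 A0 => //; exact: subIsetl.
have A'lty : (mu (A `&` `]a, b]%classic) < +oo)%E by rewrite A'0.
have [U [oU AU Ud]] := lebesgue_regularity_outer mAb A'lty d0.
pose W := U `&` `]a - 1, b + 1[%classic.
have oW : open W by apply: openI => //; exact: interval_open.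
have mU : measurable (U : set (measurableTypeR R)) by exact: open_measurable.
have mW : measurable (W : set (measurableTypeR R)) by exact: open_measurable.
have AW : A `&` `]a, b]%classic `<=` W.
  move=> z Az; split; first exact: AU.
  move: Az => [_] /=; rewrite !in_itv/= => /andP[az zb].
  by rewrite (le_lt_trans zb) ?ltrDl// andbT (lt_trans _ az)// ltrBlDr ltrDl.
have Wd : (mu W < d%:E)%E.
  apply: le_lt_trans Ud; apply: (@le_trans _ _ (mu U)).
    by apply: le_measure; rewrite ?inE//; exact: subIsetl.
  have -> : U = (U `\` (A `&` `]a, b]%classic)) `|` (A `&` `]a, b]%classic).
    by rewrite setUC setDUK.
  have mUA : measurable (U `\` (A `&` `]a, b]%classic) : set (measurableTypeR R)).
    exact: measurableD.
  rewrite (le_trans (measureU2 _ mUA mAb))// [X in (_ + X)%E](_ : _ = 0%E)//.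
  by rewrite adde0 setDUl setDv setU0 setDDl setUid.
apply: le_trans (H W oW _ Wd); last exact: subIsetr.
rewrite /nu/= /mfrestr /mrestr; apply: le_measure; rewrite ?inE//.
  exact: measurableI.
by move=> z zA; split; [exact: AW|case: zA].
Qed.

Lemma monotone_density : exists2 h : R -> R,
  mu.-integrable setT (EFin \o h) &
  forall x, a <= x -> x <= b -> ((g x - g a)%:E = \int[mu]_(t in `]a, x]) (h t)%:E)%E.
Proof.
have [f [f0 ffin fi fE]] := radon_nikodym_sigma_finite nu_dominated.
have fK : EFin \o (fine \o f) = f by apply/funext => t /=; rewrite fineK.
exists (fine \o f); first by rewrite fK.
move=> x ax xb; rewrite -nu_oc// fE//.
by apply: eq_integral => t _; rewrite -[in LHS]fK.
Qed.

End monotone_density.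

(** * The fundamental theorem of calculus for absolutely continuous functions *)

Section ac_ftc.
Context {R : realType}.
Implicit Types (a b : R) (f : R -> R).
Local Notation mu := (@lebesgue_measure R).

(** Jordan decomposition: f = V - (V - f), where both parts are nondecreasing and absolutely
    continuous, so that each has a density. *)
Lemma absolutely_continuous_density a b f : a < b ->
  absolutely_continuous_on a b f -> exists2 h : R -> R,
  mu.-integrable setT (EFin \o h) &
  forall x, a <= x -> x <= b -> f x - f a = \int[mu]_(t in `]a, x]) h t.
Proof.
move=> ab /list_ac_absolutely_continuous acf.
pose V := variation_function a f.
have acV : list_ac a b V by exact: list_ac_variation_function.
have VB x y : a <= x -> x <= y -> y <= b -> `|f y - f x| <= V y - V x.
  move=> ax xy yb; rewrite -lee_fin (variation_functionB acf)//.
  exact: total_variation_ge.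
have [h1 ih1 E1] : exists2 h : R -> R, mu.-integrable setT (EFin \o h) &
  forall x, a <= x -> x <= b -> ((V x - V a)%:E = \int[mu]_(t in `]a, x]) (h t)%:E)%E.
  apply: (@monotone_density R a b V) => // x y ax xy yb.
  by rewrite -subr_ge0; apply: le_trans (VB _ _ ax xy yb).
have [h2 ih2 E2] : exists2 h : R -> R, mu.-integrable setT (EFin \o h) &
  forall x, a <= x -> x <= b -> (((V \- f) x - (V \- f) a)%:E = \int[mu]_(t in `]a, x]) (h t)%:E)%E.
  apply: (@monotone_density R a b (V \- f)) => //; last exact: list_acB.
  move=> x y ax xy yb /=; have := VB _ _ ax xy yb; have := ler_norm (f y - f x).
  by lra.
exists (h1 \- h2).
  rewrite (_ : EFin \o _ = (EFin \o h1) \- (EFin \o h2))%E//.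
  by apply: integrableB.
move=> x ax xb.
have i1 : mu.-integrable `]a, x] (EFin \o h1) by exact: integrableS ih1.
have i2 : mu.-integrable `]a, x] (EFin \o h2) by exact: integrableS ih2.
rewrite RintegralB//.
have -> : \int[mu]_(t in `]a, x]) h1 t = V x - V a by rewrite /Rintegral -E1.
have -> : \int[mu]_(t in `]a, x]) h2 t = (V \- f) x - (V \- f) a.
  by rewrite /Rintegral -E2.
by rewrite /=; lra.
Qed.

(** At Lebesgue points of the density [h], the indefinite integral of [h] has derivative [h]; so [h]
    may be replaced by the derivative of [f] under the integral. *)
Lemma absolutely_continuous_increment_le a b f : a < b ->
  absolutely_continuous_on a b f -> measurable_fun `]a, b[ (f^`()%classic) ->
  (`|f b - f a|%:E <= \int[mu]_(x in `]a, b[) `|f^`()%classic x|%:E)%E.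
Proof.
move=> ab acf mf; have [h ih hE] := absolutely_continuous_density ab acf.
have ihab : mu.-integrable `]a, b] (EFin \o h) by exact: integrableS ih.
rewrite hE ?lexx ?(ltW ab)//.
have mab : measurable (`]a, b]%classic : set (measurableTypeR R)) by exact: measurable_itv.
have fin_h := integrable_fin_num mab ihab.
rewrite /Rintegral -abse_EFin fineK//.
have mh : measurable_fun setT h by case/integrableP : ih => /measurable_EFinP.
have mhab : measurable_fun `]a, b] (EFin \o h) by case/integrableP : ihab.
apply: (le_trans (le_abse_integral mu mab mhab)).
(* The right endpoint is dropped: differentiating at a point uses the integral representation on
   both sides of it. *)
rewrite -(@integral_itv_bndo_bndc _ _ _ (fun x => `|(EFin \o h) x|%E)); last first.
  apply/measurable_EFinP; apply: measurableT_comp => //.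
  exact: measurable_funS mh.
rewrite le_eqVlt; apply/orP; left; apply/eqP.
apply: ge0_ae_eq_integral => //.
- by apply/measurable_EFinP; apply: measurableT_comp => //; exact: measurable_funS mh.
- by apply/measurable_EFinP; apply: measurableT_comp.
have loch : locally_integrable setT h by apply: open_integrable_locally => //; exact: openT.
have := lebesgue_differentiation loch.
apply: filterS; first exact: (ae_filter_ringOfSetsType mu).
move=> x lpt /=; rewrite in_itv/= => /andP[ax xb].
have [dF FE] := @FTC1_lebesgue_pt R h (BRight a) x b xb ihab ax lpt.
congr (`|_|%:E); rewrite -FE !derive1E.
have E : {near x, f =1 (fun y => \int[mu]_(t in `]a, y]) h t + f a)}.
  have : \forall z \near x, z \in `]a, b[ by apply: near_in_itvoo; rewrite in_itv/= ax.
  apply: filterS => z; rewrite in_itv/= => /andP[az zb].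
  by rewrite -hE ?ltW// subrK.
rewrite (near_eq_derive _ E).
have := deriveD dF (derivable_cst (f a) x 1).
by rewrite derive_cst addr0 => <-.
Qed.

End ac_ftc.

(** * Increments and energy *)

Section elementary_integrals.
Context {R : realType}.
Implicit Types (a b r s x : R).
Local Notation mu := (@lebesgue_measure R).

Lemma measurable_itvR (i : interval R) : measurable ([set` i] : set (measurableTypeR R)).
Proof. exact: measurable_itv. Qed.

Lemma integral_itvcc_inv r s : 0 < r -> r <= s ->
  (\int[mu]_(x in `[r, s]) (x^-1)%:E = (ln s - ln r)%:E)%E.
Proof.
move=> r0; rewrite le_eqVlt => /predU1P[<-|rs].
  by rewrite set_itv1 integral_set1 subrr.
have pos x : x \in `[r, s] -> 0 < x.
  by rewrite in_itv/= => /andP[rx _]; exact: lt_le_trans rx.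
have cV x : 0 < x -> {for x, continuous (fun x : R => x^-1)}.
  by move=> x0; apply: inv_continuous; rewrite gt_eqF.
have cN : {within `[r, s], continuous (fun x : R => x^-1)}.
  apply: continuous_in_subspaceT => x /set_mem xrs; apply: cV.
  by apply: pos.
rewrite (@continuous_FTC2 R (fun x => x^-1) (@ln R) r s) ?EFinB//.
- split.
  + move=> x /subset_itv_oo_cc /pos x0.
    by have [] := is_derive1_ln x0.
  + by apply: cvg_at_right_filter; exact: continuous_ln.
  + by apply: cvg_at_left_filter; apply: continuous_ln; exact: lt_trans rs.
- move=> x /subset_itv_oo_cc /pos x0; rewrite derive1E.
  by have [_ ->] := is_derive1_ln x0.
Qed.

Lemma measurable_inv_pos (D : set (measurableTypeR R)) : D `<=` `]0, +oo[ ->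
  measurable D -> measurable_fun D (fun x : R => x^-1).
Proof.
move=> D0 mD; apply: (@eq_measurable_fun _ _ _ _ _ (fun x : R => x `^ (-1))).
  by move=> x /set_mem/D0/=; rewrite in_itv/= andbT => x0; rewrite powR_inv1// ltW.
exact: (measurable_funS measurableT (@subsetT _ _) (measurable_powR _)).
Qed.

Lemma integral_itvoo_inv r s : 0 < r -> r <= s ->
  (\int[mu]_(x in `]r, s[) (x^-1)%:E = (ln s - ln r)%:E)%E.
Proof.
move=> r0 rs; rewrite -integral_itvcc_inv//.
rewrite -(@integral_itv_bndoo R r s (fun x => (x^-1)%:E) true false)//.
apply/measurable_EFinP; apply: measurable_inv_pos; last exact: measurable_itvR.
by move=> x /=; rewrite !in_itv/= andbT => /andP[rx _]; exact: lt_trans rx.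
Qed.

(** Hoelder's inequality on the whole line, for [f] and [g] extended by zero outside [D]. *)
Lemma hoelder_on (D : set (measurableTypeR R)) (f g : R -> R) (p q : R) : measurable D ->
  measurable_fun D f -> measurable_fun D g -> 0 < p -> 0 < q -> p^-1 + q^-1 = 1 ->
  (\int[mu]_(x in D) `|f x * g x|%:E <=
   (\int[mu]_(x in D) (`|f x| `^ p)%:E) `^ p^-1 *
   (\int[mu]_(x in D) (`|g x| `^ q)%:E) `^ q^-1)%E.
Proof.
move=> mD mf mg p0 q0 pq.
have mf' : measurable_fun setT (f \_ D) by exact/(measurable_restrictT _ mD).
have mg' : measurable_fun setT (g \_ D) by exact/(measurable_restrictT _ mD).
have := hoelder mu mf' mg' p0 q0 pq.
rewrite Lnorm1 unlock.
have E (k : R -> R) t : 0 < t ->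
  (\int[mu]_x (`|((k \_ D) x)%:E| `^ t) = \int[mu]_(x in D) (`|k x| `^ t)%:E)%E.
  move=> t0; rewrite [RHS]integral_mkcond; apply: eq_integral => x _.
  rewrite !patchE; case: ifPn => // _.
  by rewrite abse_EFin normr0 poweR_EFin powR0// gt_eqF.
rewrite !E// (_ : (\int[mu]_x _)%E = (\int[mu]_(x in D) `|f x * g x|%:E)%E)//.
rewrite [RHS]integral_mkcond; apply: eq_integral => x _.
by rewrite /= !patchE; case: ifPn => //; rewrite mul0r normr0.
Qed.

Lemma poweR_ler (x y : \bar R) p : 0 <= p -> (0 <= x)%E -> (x <= y)%E ->
  (x `^ p <= y `^ p)%E.
Proof.
move=> p0 x0 xy; apply: gt0_ler_poweR => //; rewrite in_itv/= leey andbT//.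
exact: le_trans xy.
Qed.

Lemma measurable_norm_powR D (v : R -> R) p : measurable_fun D v ->
  measurable_fun D (fun x => `|v x| `^ p).
Proof.
move=> mv; apply: (measurableT_comp (measurable_powR p)).
exact: measurableT_comp.
Qed.

(** Hoelder's inequality for |u'| = (|u'| x^t) x^(-t) with t = (p - 1) / p: the first factor carries
    the weight of the energy, and the second one integrates to a logarithm because t q = 1. *)
Lemma increment_powR_le p (u : R -> R) r s : 1 < p -> 0 < r -> r <= s ->
  locally_absolutely_continuous u -> measurable_fun (`]0, +oo[ : set R) (u^`()%classic) ->
  ((`|u s - u r| `^ p)%:E <=
   \int[mu]_(x in `]r, s[) (`|u^`()%classic x| `^ p * x `^ (p - 1))%:E *
   ((ln s - ln r) `^ (p - 1))%:E)%E.
Proof.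
move=> p1 r0; have p0 : 0 < p by lra.
have pn0 : p != 0 by rewrite gt_eqF.
rewrite le_eqVlt => /predU1P[<-|rs] acu mu'.
  rewrite subrr normr0 powR0// mule_ge0// ?lee_fin ?powR_ge0// integral_ge0// => x _.
  by rewrite lee_fin mulr_ge0// powR_ge0.
have pos x : x \in `]r, s[ -> 0 < x.
  by rewrite in_itv/= => /andP[rx _]; exact: lt_trans rx.
have mrs : measurable_fun (`]r, s[ : set (measurableTypeR R)) (u^`()%classic).
  apply: measurable_funS mu'; first exact: measurable_itvR.
  by move=> x /pos; rewrite /= in_itv/= andbT.
have I1 := absolutely_continuous_increment_le rs (acu r s r0 (ltW rs)) mrs.
pose t := (p - 1) / p.
have tp : t * p = p - 1 by rewrite /t -mulrA mulVf// mulr1.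
pose q := p / (p - 1).
have q0 : 0 < q by rewrite divr_gt0// subr_gt0.
have pq : p^-1 + q^-1 = 1 by rewrite /q invf_div; field.
have tq : - t * q = - 1 by rewrite /t /q; field; rewrite pn0 subr_eq0 gt_eqF.
pose f x : R := `|u^`()%classic x| * x `^ t.
pose g x : R := x `^ (- t).
have mf : measurable_fun (`]r, s[ : set (measurableTypeR R)) f.
  apply: measurable_funM; first exact: measurableT_comp.
  exact: (measurable_funS measurableT (@subsetT _ _) (measurable_powR t)).
have mg : measurable_fun (`]r, s[ : set (measurableTypeR R)) g.
  exact: (measurable_funS measurableT (@subsetT _ _) (measurable_powR (- t))).
have := hoelder_on (measurable_itvR _) mf mg p0 q0 pq.
have -> : (\int[mu]_(x in `]r, s[) `|f x * g x|%:E =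
    \int[mu]_(x in `]r, s[) `|u^`()%classic x|%:E)%E.
  apply: eq_integral => x /set_mem/pos x0; congr (_%:E).
  rewrite /f /g -mulrA -powRD; last by rewrite addrN eqxx gt_eqF.
  by rewrite addrN powRr0 mulr1 normr_id.
have -> : (\int[mu]_(x in `]r, s[) (`|f x| `^ p)%:E =
    \int[mu]_(x in `]r, s[) (`|u^`()%classic x| `^ p * x `^ (p - 1))%:E)%E.
  apply: eq_integral => x /set_mem/pos x0; congr (_%:E).
  by rewrite /f ger0_norm ?mulr_ge0 ?powR_ge0// powRM ?powR_ge0// -powRrM tp.
have -> : (\int[mu]_(x in `]r, s[) (`|g x| `^ q)%:E = (ln s - ln r)%:E)%E.
  rewrite -integral_itvoo_inv ?ltW//; apply: eq_integral => x /set_mem/pos x0.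
  by rewrite /g ger0_norm ?powR_ge0// -powRrM tq powR_inv1 ?ltW.
move=> /(le_trans I1) /(@poweR_ler _ _ p (ltW p0)) => /(_ (normr_ge0 _)).
rewrite poweR_EFin => /le_trans; apply.
rewrite poweRM ?poweR_ge0// -!poweRrM mulVf// poweRe1; last first.
  by apply: integral_ge0 => x _; rewrite lee_fin mulr_ge0// powR_ge0.
by rewrite poweR_EFin /q invf_div mulrAC mulfK// -mulrA mulVf// mulr1.
Qed.

End elementary_integrals.

(** * Moser's level set estimate *)

Section powR_inequalities.
Context {R : realType}.
Implicit Types (p q x y l s t : R).

Lemma powR_le p x y : 0 <= p -> 0 <= x -> x <= y -> x `^ p <= y `^ p.
Proof.
by move=> p0 x0 xy; apply: ge0_ler_powR => //; rewrite nnegrE// (le_trans x0).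
Qed.

(** Convexity of the power, as x + y is the combination of x / (1 - l) and y / l with weights 1 - l
    and l. *)
Lemma powR_addr_le q l x y : 1 <= q -> 0 < l -> l < 1 -> 0 <= x -> 0 <= y ->
  (x + y) `^ q <= (1 - l) `^ (1 - q) * x `^ q + l `^ (1 - q) * y `^ q.
Proof.
move=> q1 l0 l1 x0 y0.
have l0' : 0 < 1 - l by rewrite subr_gt0.
have q0 : 0 < q by exact: lt_le_trans q1.
have E a z : 0 < a -> 0 <= z -> a `^ (1 - q) * z `^ q = a * (a^-1 * z) `^ q.
  move=> a0 z0; rewrite powRM ?invr_ge0 ?(ltW a0)// mulrA; congr (_ * _).
  rewrite powRB; last by rewrite (gt_eqF a0) implybT.
  rewrite powRr1 ?(ltW a0)//; congr (_ * _).
  by rewrite -(powR_inv1 (ltW a0)) -powRrM mulN1r powRN.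
rewrite !E//.
have := @convex_powR R q q1 (Itv01 (ltW l0) (ltW l1)) (l^-1 * y) ((1 - l)^-1 * x).
rewrite !inE/= !in_itv/= !andbT => /(_ (mulr_ge0 _ y0) (mulr_ge0 _ x0)).
rewrite !invr_ge0 (ltW l0) (ltW l0') => /(_ isT isT).
move=> h; rewrite convRE [X in X `^ _ <= _]convRE /unstable.onem /= in h.
rewrite addrC [leRHS]addrC; apply: le_trans h.
by rewrite !mulrA divff ?gt_eqF// divff ?gt_eqF// !mul1r.
Qed.

(** Young's inequality for the product of 1 - x and 1, with exponents s and s / (s - 1); s = 1 is
    separate, since its conjugate exponent would be infinite. *)
Lemma bernoulli_powR s x : 1 <= s -> 0 <= x -> x <= 1 -> 1 - s * x <= (1 - x) `^ s.
Proof.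
move=> s1 x0 x1; have x1' : 0 <= 1 - x by rewrite subr_ge0.
move: s1; rewrite le_eqVlt => /predU1P[<-|s1]; first by rewrite mul1r powRr1.
have s0 : 0 < s by exact: lt_trans s1.
have sn1 : s - 1 != 0 by rewrite subr_eq0 gt_eqF.
have := @conjugate_powR R (1 - x) 1 s (s / (s - 1)) x1' ler01 s0.
rewrite divr_gt0 ?subr_gt0// => /(_ isT).
have -> : s^-1 + (s / (s - 1))^-1 = 1 by field; rewrite sn1 gt_eqF.
move=> /(_ erefl); rewrite powR1 mulr1 => h.
rewrite -subr_ge0; rewrite -subr_ge0 in h.
rewrite (_ : _ - _ = s * ((1 - x) `^ s / s + 1 / (s / (s - 1)) - (1 - x))).
  by rewrite mulr_ge0// ltW.
by field; rewrite sn1 gt_eqF.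
Qed.

(** The exponent is at least -1 because p >= 2, so the power is at most 1 / (1 - l), and this is at
    most 1 + 2 l for l <= 1 / 2. *)
Lemma powRN_le_1D2 p l : 2 <= p -> 0 <= l -> l <= 2^-1 ->
  (1 - l) `^ (- (p - 1)^-1) <= 1 + 2 * l.
Proof.
move=> p2 l0 l2; apply: (@le_trans _ _ ((1 - l)`^ (-1))).
  apply: ger_powR; first by apply/andP; split; lra.
  by rewrite lerN2 invf_le1; lra.
have l1 : 0 < 1 - l by lra.
rewrite powR_inv1 ?(ltW l1)// -[leLHS]mul1r ler_pdivrMr//.
by nra.
Qed.

End powR_inequalities.

(** * Almost extremal points *)

Section moser.
Context {R : realType}.
Variable p : R.
Hypothesis p2 : 2 <= p.
Let q := p / (p - 1).
Local Notation mu := (@lebesgue_measure R).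

Let p1 : 0 < p - 1. Proof. by move: p2; lra. Qed.
Let p1n : p - 1 != 0. Proof. by rewrite gt_eqF. Qed.

Lemma conjugate_exponent_ge1 : 1 <= q.
Proof. by rewrite /q ler_pdivlMr//; move: p2; lra. Qed.

Lemma one_sub_conjugate : 1 - q = - (p - 1)^-1.
Proof. by rewrite /q; field. Qed.

Lemma powR_conjugateE x : x `^ q = (x `^ p) `^ (p - 1)^-1.
Proof. by rewrite /q powRrM. Qed.

Lemma powR_conjugate_le x A t : 0 <= x -> 0 <= A -> 0 <= t -> x `^ p <= A * t `^ (p - 1) ->
  x `^ q <= A `^ (p - 1)^-1 * t.
Proof.
move=> x0 A0 t0 h; rewrite powR_conjugateE.
have := powR_le (_ : 0 <= (p - 1)^-1) (powR_ge0 _ _) h.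
rewrite invr_ge0 ltW// => /(_ isT) /le_trans; apply.
by rewrite powRM ?powR_ge0// -powRrM divff// powRr1.
Qed.

(** Chosen so that 2 l t1 = [moser_gap] s for the weight [l] of the next proof; then t1 >=
    [moser_gap] s means l <= 1 / 2. *)
Definition moser_gap : R := 2 `^ p * (p - 1).

(* Being almost extremal at t1 uses up almost all of the energy, so w2 cannot
   be almost extremal at a much larger t2. *)
Lemma moser_two_points s t1 t2 w1 w2 d A1 A2 : 0 < s -> moser_gap * s <= t1 -> t1 <= t2 ->
  0 <= w1 -> 0 <= w2 -> 0 <= d -> 0 <= A1 -> 0 <= A2 -> A1 + A2 <= 1 ->
  w1 `^ p <= A1 * t1 `^ (p - 1) -> w2 <= w1 + d -> d `^ p <= A2 * (t2 - t1) `^ (p - 1) ->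
  t1 - w1 `^ q <= s -> t2 - w2 `^ q <= s -> t2 - t1 <= 2 * (1 + moser_gap) * s.
Proof.
have := p2; have := p1 => p1' p2'.
move=> s0 gs t12 w10 w20 d0 A10 A20 A12 hw1 hw2 hd h1 h2.
have two_p : 2 * 2 `^ (p - 1) = 2 `^ p :> R.
  by rewrite mulr_powRB1//; lra.
have c1 : 1 <= 2 `^ (p - 1) :> R.
  by rewrite -[leLHS](powRr0 2); apply: ler_powR; lra.
have gap1 : 2 <= moser_gap by rewrite /moser_gap -two_p; nra.
have t1s : s <= t1 by nra.
have t10 : 0 < t1 by exact: lt_le_trans t1s.
have A1le1 : A1 <= 1 by lra.
have w1q : w1 `^ q <= t1.
  apply: le_trans (powR_conjugate_le w10 A10 (ltW t10) hw1) _.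
  rewrite -[leRHS]mul1r ler_pM2r//.
  have ip1 : 0 <= (p - 1)^-1 by rewrite invr_ge0 ltW.
  by have := powR_le ip1 A10 A1le1; rewrite powR1.
(* A bound for the energy beyond [t1]: since (t1 - s)^(p - 1) <= w1^p <= A1 t1^(p - 1), Bernoulli's
   inequality gives A1 >= 1 - e. *)
pose e := (p - 1) * s / t1.
have e0 : 0 < e by rewrite divr_gt0// mulr_gt0.
have A2e : A2 <= e.
  suff : 1 - (p - 1) * (s / t1) <= A1 by rewrite /e mulrA; lra.
  have st : s / t1 <= 1 by rewrite ler_pdivrMr// mul1r.
  have := @bernoulli_powR R (p - 1) (s / t1) _ (divr_ge0 (ltW s0) (ltW t10)) st.
  move=> /(_ ltac:(lra))/le_trans; apply.
  rewrite -(ler_pM2r (powR_gt0 (p - 1) t10)); apply: le_trans hw1.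
  rewrite -powRM ?subr_ge0 ?(ltW t10)// mulrBl mul1r mulfVK ?gt_eqF//.
  have -> : w1 `^ p = (w1 `^ q) `^ (p - 1) by rewrite /q -powRrM -mulrA mulVf// mulr1.
  by apply: powR_le; [lra|lra|lra].
(* The factor 2^(p - 1) makes l^(1 - q) e^(1 / (p - 1)) equal to 1 / 2, so that the increment [d]
   accounts for at most half of t2 - t1. *)
pose l := 2 `^ (p - 1) * e.
have l0 : 0 < l by rewrite mulr_gt0// powR_gt0.
have lt1 : 2 * l * t1 = moser_gap * s.
  by rewrite /l /e /moser_gap -two_p; field; rewrite gt_eqF.
have l2 : l <= 2^-1 by nra.
have l1 : l < 1 by lra.
have dq : l `^ (1 - q) * d `^ q <= 2^-1 * (t2 - t1).
  have t210 : 0 <= t2 - t1 by lra.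
  have hd' : d `^ p <= e * (t2 - t1) `^ (p - 1).
    by apply: (le_trans hd); apply: ler_wpM2r => //; exact: powR_ge0.
  have h := powR_conjugate_le d0 (ltW e0) t210 hd'.
  apply: le_trans (ler_wpM2l (powR_ge0 _ _) h) _.
  rewrite one_sub_conjugate /l powRM ?powR_ge0 ?(ltW e0)// -powRrM mulrN divff//.
  rewrite powR_inv1// !mulrA -(mulrA 2^-1) -powRD ?(gt_eqF e0) ?implybT//.
  by rewrite addNr powRr0 mulr1.
have w2q : w2 `^ q <= (1 + 2 * l) * t1 + 2^-1 * (t2 - t1).
  have q1 := conjugate_exponent_ge1.
  apply: (@le_trans _ _ ((w1 + d) `^ q)); first by apply: powR_le => //; lra.
  apply: le_trans (powR_addr_le q1 l0 l1 w10 d0) _.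
  apply: lerD => //; rewrite one_sub_conjugate.
  apply: ler_pM; rewrite ?powR_ge0//.
  exact: powRN_le_1D2 (ltW l0) l2.
(* With t2 - s <= w2^q and 2 l t1 = [moser_gap] s, half of t2 - t1 is absorbed on the left. *)
by nra.
Qed.


(** * Level sets in the logarithmic variable and Moser's integral inequality *)

Section level_sets.
(** [g r s] stands for the energy between the radii [r] and [s]: it is nonnegative, adjacent pieces
    add up to at most 1, and it controls the increments of [z]. *)
Variables (N r0 : R) (z : R -> R) (g : R -> R -> R).
Hypotheses (N0 : 0 < N) (r00 : 0 < r0) (zr0 : z r0 = 0).
Hypothesis z0 : forall r, 0 < r -> 0 <= z r.
Hypothesis mz : measurable_fun (`]0, r0[ : set R) z.
Hypothesis g0 : forall r s, 0 < r -> r <= s -> 0 <= g r s.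
Hypothesis gD : forall r s, 0 < r -> r <= s -> s <= r0 -> g r s + g s r0 <= 1.
Hypothesis zg : forall r s, 0 < r -> r <= s -> s <= r0 ->
  `|z r - z s| `^ p <= g r s * (N * (ln s - ln r)) `^ (p - 1).

(** The logarithmic variable with origin at [r0], increasing towards 0: r^N = r0^N e^(-T). [F]
    measures how far [z] is from being extremal. *)
Let T r := N * (ln r0 - ln r).
Let F r := T r - z r `^ q.

Let T_ge0 r : 0 < r -> r <= r0 -> 0 <= T r.
Proof. by move=> r_gt0 rr0; rewrite mulr_ge0 ?subr_ge0 ?ler_ln ?posrE// ltW. Qed.

Let zT r : 0 < r -> r <= r0 -> z r `^ p <= g r r0 * T r `^ (p - 1).
Proof.
by move=> r_gt0 rr0; have := zg r_gt0 rr0 (lexx _); rewrite zr0 subr0 ger0_norm// z0.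
Qed.

Let g_le1 r : 0 < r -> r <= r0 -> g r r0 <= 1.
Proof.
by move=> r_gt0 rr0; have := gD r_gt0 rr0 (lexx _); have := g0 r00 (lexx r0); lra.
Qed.

(** Energy at most 1 gives z^p <= T^(p - 1), that is, z^q <= T. *)
Let F_ge0 r : 0 < r -> r <= r0 -> 0 <= F r.
Proof.
move=> r_gt0 rr0; rewrite subr_ge0.
have := powR_conjugate_le (z0 r_gt0) ler01 (T_ge0 r_gt0 rr0).
rewrite powR1 !mul1r; apply; apply: le_trans (zT r_gt0 rr0) _.
by rewrite ler_piMl ?powR_ge0// g_le1.
Qed.

Let level s := `]0, r0[ `&` [set r | F r <= s].

Let mF : measurable_fun (`]0, r0[ : set R) F.
Proof.
apply: measurable_funB.
  apply: measurable_funM => //; apply: measurable_funB => //.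
  by apply: measurable_funTS; exact: measurable_ln.
exact: (measurableT_comp (measurable_powR q)).
Qed.

Let mD : measurable (`]0, r0[ : set (measurableTypeR R)).
Proof. exact: measurable_itvR. Qed.

Let m_level s : measurable (level s : set (measurableTypeR R)).
Proof.
exact: (mF mD (measurable_itvR `]-oo, s])).
Qed.

(** The two-point estimate for t1 = T(r1) and t2 = T(r2): the smaller radius has the larger [T], and
    the two energies are those of (r1, r0) and (r2, r1). *)
Let level_gap s r1 r2 : 0 < s -> level s r1 -> level s r2 -> r2 <= r1 ->
  moser_gap * s <= T r1 -> T r2 - T r1 <= 2 * (1 + moser_gap) * s.
Proof.
move=> s0 [/=]; rewrite !in_itv/= => /andP[r1_gt0 r1r0] F1 [/= + F2].
rewrite in_itv/= => /andP[r2_gt0 r2r0] r21 gs.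
have T12 : T r2 - T r1 = N * (ln r1 - ln r2) by rewrite /T; ring.
apply: (@moser_two_points s _ _ (z r1) (z r2) `|z r2 - z r1| (g r1 r0) (g r2 r1)) => //.
- by rewrite -subr_ge0 T12 mulr_ge0 ?subr_ge0 ?ler_ln ?posrE// ltW.
- exact: z0.
- exact: z0.
- by apply: g0 => //; exact: ltW.
- exact: g0.
- by rewrite addrC; apply: gD => //; exact: ltW.
- by apply: zT => //; exact: ltW.
- by rewrite -lerBlDl ler_norm.
- by rewrite T12; apply: zg => //; exact: ltW.
Qed.

Let minv (D : set (measurableTypeR R)) : D `<=` `]0, +oo[ -> measurable D ->
  measurable_fun D (fun x : R => (x^-1)%:E).
Proof. by move=> D0 mD'; apply/measurable_EFinP; exact: measurable_inv_pos. Qed.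

Let le_integral_setU (A B : set (measurableTypeR R)) (f : R -> \bar R) :
  measurable A -> measurable B -> measurable_fun (A `|` B) f ->
  (forall x, (A `|` B) x -> (0 <= f x)%E) ->
  (\int[mu]_(x in A `|` B) f x <= \int[mu]_(x in A) f x + \int[mu]_(x in B) f x)%E.
Proof.
move=> mA mB mf f0.
have AB : A `|` B = A `|` (B `\` A).
  apply/seteqP; split => x; last by move=> [|[]]; [left|right].
  by move=> [|Bx]; [left|have [|nA] := pselect (A x); [left|right]].
have mBA : measurable (B `\` A) by exact: measurableD.
rewrite AB ge0_integral_setU -?AB//; last first.
  by apply/disj_setPS => x [? []].
rewrite leeD2l//; apply: ge0_subset_integral => //.
- by apply: measurable_funS mf => //; exact: measurableU.
- by move=> x Bx; apply: f0; right.
Qed.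

(** dr / r is Lebesgue measure in ln r. There the level set is covered by the part with T <=
    [moser_gap] s, of length [moser_gap] s / N, and by one interval of length 4 (1 + [moser_gap]) s
    / N around any of its points with larger [T]. *)
Let level_integral s : 0 < s ->
  (\int[mu]_(r in level s) (r^-1)%:E <= ((moser_gap + 4 * (1 + moser_gap)) * s / N)%:E)%E.
Proof.
move=> s0.
have gap0 : 0 <= moser_gap by rewrite /moser_gap mulr_ge0 ?powR_ge0// ltW.
(* [expR a] is the radius where T = [moser_gap] s. *)
pose a := ln r0 - moser_gap * s / N.
have ar0 : expR a <= r0.
  rewrite -[leRHS]lnK ?posrE// ler_expR /a gerBl.
  by apply: divr_ge0; [apply: mulr_ge0 => //|]; exact: ltW.
have [b lb] : exists b : R, level s `<=` `[expR a, r0] `|`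
    `[expR (b - 2 * (1 + moser_gap) * s / N), expR (b + 2 * (1 + moser_gap) * s / N)].
  have [[r1 [l1 T1]]|none] := pselect (exists r1, level s r1 /\ moser_gap * s <= T r1).
    exists (ln r1) => r lr.
    have [r1_gt0 r1r0] : 0 < r1 /\ r1 < r0 by case: l1 => /=; rewrite in_itv/= => /andP[].
    have [r_gt0 rr0] : 0 < r /\ r < r0 by case: lr => /=; rewrite in_itv/= => /andP[].
    have [Tr|/ltW Tr] := leP (T r) (moser_gap * s).
      left; rewrite /= in_itv/= (ltW rr0) andbT -[leRHS]lnK ?posrE// ler_expR.
      by rewrite /a lerBlDr -lerBlDl ler_pdivlMr// mulrC.
    right; rewrite /= in_itv/=.
    have T1r : T r - T r1 = N * (ln r1 - ln r) by rewrite /T; ring.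
    have c0 : 0 <= 2 * (1 + moser_gap) * s by rewrite !mulr_ge0// ?addr_ge0// ltW.
    have : `|T r - T r1| <= 2 * (1 + moser_gap) * s.
      have [rr1|/ltW rr1] := leP r r1.
        rewrite ger0_norm; first exact: level_gap.
        by rewrite T1r mulr_ge0 ?subr_ge0 ?ler_ln ?posrE// ltW.
      rewrite distrC ger0_norm; first exact: level_gap.
      by rewrite -oppr_le0 opprB T1r pmulr_rle0// subr_le0 ler_ln.
    rewrite T1r normrM gtr0_norm// mulrC -ler_pdivlMr// ler_norml => /andP[h1 h2].
    have rE : r = expR (ln r) by rewrite lnK.
    by rewrite rE !ler_expR; lra.
  (* Here the first part covers the level set, and the centre 0 is arbitrary. *)
  exists 0 => r lr; left; rewrite /= in_itv/=.
  have [r_gt0 rr0] : 0 < r /\ r < r0 by case: lr => /=; rewrite in_itv/= => /andP[].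
  rewrite (ltW rr0) andbT -[leRHS]lnK ?posrE// ler_expR.
  rewrite /a lerBlDr -lerBlDl ler_pdivlMr// mulrC leNgt; apply/negP => h.
  by apply: none; exists r; split => //; exact: ltW.
set A := `[expR a, r0]%classic in lb; set B := `[_, _]%classic in lb.
have A0 : A `<=` `]0, +oo[.
  by move=> x /=; rewrite !in_itv/= andbT => /andP[+ _]; exact: (lt_le_trans (expR_gt0 _)).
have B0 : B `<=` `]0, +oo[.
  by move=> x /=; rewrite !in_itv/= andbT => /andP[+ _]; exact: (lt_le_trans (expR_gt0 _)).
have mA : measurable (A : set (measurableTypeR R)) by exact: measurable_itvR.
have mB : measurable (B : set (measurableTypeR R)) by exact: measurable_itvR.
have AB0 : A `|` B `<=` `]0, +oo[ by move=> x [/A0|/B0].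
have inv0 (D : set R) x : D `<=` `]0, +oo[ -> D x -> (0 <= (x^-1)%:E)%E.
  by move=> D0 /D0/=; rewrite in_itv/= andbT lee_fin invr_ge0 => /ltW.
apply: (@le_trans _ _ (\int[mu]_(r in A `|` B) (r^-1)%:E)%E).
  apply: ge0_subset_integral => //; first exact: measurableU.
  by apply: minv => //; exact: measurableU.
  by move=> x; exact: inv0.
apply: (le_trans (le_integral_setU mA mB _ _)).
- by apply: minv => //; exact: measurableU.
- by move=> x; exact: inv0.
have c0 : 0 <= 2 * (1 + moser_gap) * s / N.
  by rewrite divr_ge0 ?mulr_ge0 ?addr_ge0 ?(ltW s0) ?(ltW N0).
rewrite !integral_itvcc_inv ?expR_gt0//; last by rewrite ler_expR; lra.
rewrite !expRK -EFinD lee_fin /a le_eqVlt; apply/orP; left; apply/eqP; field.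
by rewrite gt_eqF.
Qed.

(** The constant of [level_integral] times the sum of the geometric series of ratio 2 / e. *)
Definition moser_const : R :=
  (moser_gap + 4 * (1 + moser_gap)) / N / (1 - 2 * expR (-1)).

(** The integrand equals r0^N e^(-F) / r. The slice n <= F < n + 1 lies in the level set of n + 1
    and contributes at most a constant times e^(-n) (n + 1). *)
Lemma moser_integral_le :
  (\int[mu]_(r in `]0%R, r0[) (expR (z r `^ q) * r `^ (N - 1))%:E <=
   (moser_const * r0 `^ N)%:E)%E.
Proof.
have e2 : 2 * expR (-1) < 1 :> R.
  rewrite expRN -ltr_pdivlMr ?invr_gt0 ?expR_gt0// div1r invrK.
  by have := expR_gt1Dx (oner_neq0 R); lra.
have D0 : `]0, r0[%classic `<=` (`]0, +oo[%classic : set R).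
  by move=> x /=; rewrite !in_itv/= => /andP[->].
pose f n : R -> \bar R := (fun r => (expR (- n%:R))%:E * (r^-1)%:E)%E \_ (level n.+1%:R).
have f0 n r : `]0, r0[%classic r -> (0 <= f n r)%E.
  move=> /D0/=; rewrite in_itv/= andbT => r_gt0; rewrite /f patchE; case: ifPn => // _.
  by rewrite mule_ge0// lee_fin ?expR_ge0// invr_ge0 ltW.
have mf n : measurable_fun (`]0, r0[ : set (measurableTypeR R)) (f n).
  apply/measurable_restrict => //.
  apply: (measurable_funS mD (@subIsetl _ _ _)).
  apply/measurable_EFinP; apply: measurable_funM => //.
  exact: measurable_inv_pos.
have fint n : (\int[mu]_(r in `]0%R, r0[) f n r <=
   ((moser_gap + 4 * (1 + moser_gap)) / N * (2 * expR (-1)) ^+ n)%:E)%E.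
  rewrite -integral_mkcondr (_ : _ `&` _ = level n.+1%:R); last first.
    by rewrite /level setIA setIid.
  have lD : level n.+1%:R `<=` `]0, +oo[ by move=> x [/D0].
  rewrite ge0_integralZl_EFin ?expR_ge0//; last 2 first.
  - by move=> x /lD/=; rewrite in_itv/= andbT lee_fin invr_ge0 => /ltW.
  - exact: minv.
  apply: le_trans (lee_wpmul2l _ (level_integral (ltr0Sn _ n))) _.
    by rewrite lee_fin expR_ge0.
  rewrite -EFinM lee_fin exprMn -expRM_natl mulrN1.
  have gap0 : 0 <= moser_gap by rewrite /moser_gap mulr_ge0 ?powR_ge0// ltW.
  (* This turns the sum over the slices into a geometric series. *)
  have n2 : n.+1%:R <= 2 ^+ n :> R by rewrite -natrX ler_nat ltn_expl.
  rewrite (_ : _ * (_ / N) = (moser_gap + 4 * (1 + moser_gap)) / N * (n.+1%:R * expR (- n%:R))).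
    apply: ler_wpM2l; first by rewrite divr_ge0 ?(ltW N0)// addr_ge0// mulr_ge0// addr_ge0.
    by apply: ler_wpM2r => //; exact: expR_ge0.
  by field; rewrite gt_eqF.
have gap0 : 0 <= moser_gap by rewrite /moser_gap mulr_ge0 ?powR_ge0// ltW.
have mS : measurable_fun (`]0, r0[ : set (measurableTypeR R)) (fun r => \sum_(n <oo) f n r)%E.
  apply: (@ge0_emeasurable_sum _ _ _ _ f xpredT) => [n r rD _|n _]; [exact: f0|exact: mf].
have S0 r : `]0, r0[%classic r -> (0 <= \sum_(n <oo) f n r)%E.
  by move=> rD; apply: nneseries_ge0 => n _ _; exact: f0.
apply: (@le_trans _ _ (\int[mu]_(r in `]0%R, r0[) ((r0 `^ N)%:E * \sum_(n <oo) f n r))%E).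
  apply: ge0_le_integral => //.
  - by move=> r _; rewrite lee_fin mulr_ge0 ?expR_ge0 ?powR_ge0.
  - apply/measurable_EFinP; apply: measurable_funM.
      by apply: measurableT_comp => //; exact: (measurableT_comp (measurable_powR q)).
    by apply: measurable_funTS; exact: measurable_powR.
  - by apply: measurable_funeM.
  move=> r rD; move: (rD) => /=; rewrite in_itv/= => /andP[r_gt0 rr0].
  have Fr := F_ge0 r_gt0 (ltW rr0).
  (* The single term of the series at the integer part of F(r) already dominates the integrand. *)
  pose n := Num.truncn (F r).
  have /andP[n1 n2] := truncn_itv Fr.
  apply: (@le_trans _ _ ((r0 `^ N)%:E * f n r)%E); last first.
    apply: lee_wpmul2l; first by rewrite lee_fin powR_ge0.
    apply: le_trans (nneseries_lim_ge (P := xpredT) n.+1 _); last by move=> *; exact: f0.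
    rewrite big_nat_recr//= leeDr// sume_ge0// => i _; exact: f0.
  rewrite /f patchE mem_set; last by split => //; exact: ltW.
  rewrite -!EFinM lee_fin mulrA powRB; last by rewrite (gt_eqF r_gt0) implybT.
  rewrite powRr1 ?(ltW r_gt0)// mulrA; apply: ler_wpM2r; first by rewrite invr_ge0 ltW.
  have powE y : 0 < y -> y `^ N = expR (N * ln y) by move=> y0; rewrite /powR gt_eqF.
  rewrite (powE _ r_gt0) (powE _ r00) -!expRD ler_expR.
  by move: n1; rewrite /F /T /n; lra.
rewrite ge0_integralZl_EFin ?powR_ge0// mulrC EFinM.
apply: lee_wpmul2l; first by rewrite lee_fin powR_ge0.
rewrite integral_nneseries//.
apply: lime_le.
  by apply: is_cvg_nneseries => n _ _; apply: integral_ge0 => r; exact: f0.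
apply: nearW => n.
apply: (@le_trans _ _ (series (geometric
  ((moser_gap + 4 * (1 + moser_gap)) / N) (2 * expR (-1))) n)%:E).
  by rewrite /series/= -sumEFin; apply: lee_sum => i _; exact: fint.
rewrite geometric_seriesE ?lt_eqF//= lee_fin /moser_const.
apply: ler_wpM2r; first by rewrite invr_ge0 subr_ge0 ltW.
rewrite -[leRHS]mulr1; apply: ler_wpM2l.
  by rewrite divr_ge0 ?(ltW N0)// addr_ge0// mulr_ge0// addr_ge0.
by rewrite gerBl exprn_ge0// mulr_ge0// expR_ge0.
Qed.

End level_sets.
End moser.

(** * The truncated exponential series *)

Section phi.
Context {R : realType}.
Implicit Types (p t s B : R).

Let coef t j : \bar R := (t ^+ j / j`!%:R)%:E.

Let coef_ge0 t j : 0 <= t -> (0 <= coef t j)%E.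
Proof. by move=> t0; rewrite lee_fin divr_ge0// exprn_ge0. Qed.

Lemma eseries_expR t : 0 <= t -> (\sum_(0 <= j <oo) coef t j = (expR t)%:E)%E.
Proof.
move=> t0; rewrite /expR -EFin_lim; last exact: is_cvg_series_exp_coeff.
by congr (limn _); apply/funext => n; rewrite /= /series/= -sumEFin.
Qed.

Lemma phi_ge0 p t : 0 <= t -> (0 <= phi p t)%E.
Proof. by move=> t0; apply: nneseries_ge0 => j _ _; exact: coef_ge0. Qed.

Lemma phi_le_eseries p t (f : nat -> R) : 0 <= t ->
  (forall j, p - 1 <= j%:R -> t ^+ j / j`!%:R <= f j) -> (forall j, 0 <= f j) ->
  (phi p t <= \sum_(0 <= j <oo) (f j)%:E)%E.
Proof.
move=> t0 H f0; rewrite /phi [leLHS]eseries_mkcond; apply: lee_nneseries.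
  by move=> j _ _; case: ifPn => // _; exact: coef_ge0.
by move=> j _; case: ifPn => [h|_]; rewrite lee_fin// H.
Qed.

Lemma phi_le_expR p t : 0 <= t -> (phi p t <= (expR t)%:E)%E.
Proof.
move=> t0; rewrite -eseries_expR//; apply: phi_le_eseries => // j.
by rewrite divr_ge0// exprn_ge0.
Qed.

Lemma phi_nondecreasing p s t : 0 <= s -> s <= t -> (phi p s <= phi p t)%E.
Proof.
move=> s0 st; apply: lee_nneseries => [j _ _|j _]; first exact: coef_ge0.
by rewrite lee_fin ler_wpM2r ?invr_ge0// lerXn2r// nnegrE// (le_trans s0).
Qed.

(** As j >= p - 1, every term has a factor t^(p - 1), and what remains of the power is t^(j - (p -
    1)) <= B^j. *)
Lemma phi_le_powR p t B : 1 <= p -> 0 <= t -> t <= B -> 1 <= B ->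
  (phi p t <= (t `^ (p - 1) * expR B)%:E)%E.
Proof.
move=> p1 t0 tB B1; have B0 : 0 <= B by exact: le_trans B1.
have -> : (t `^ (p - 1) * expR B)%:E =
    (\sum_(0 <= j <oo) (t `^ (p - 1) * (B ^+ j / j`!%:R))%:E)%E.
  under eq_eseriesr do rewrite EFinM.
  rewrite nneseriesZl//; last by move=> j _; exact: coef_ge0.
  by rewrite eseries_expR// EFinM.
apply: phi_le_eseries => // j.
  move=> pj; rewrite mulrA; apply: ler_wpM2r; first by rewrite invr_ge0.
  rewrite -(powR_mulrn _ t0) -(powR_mulrn _ B0).
  (* At 0 exponents cannot be split, as [powR] has 0^0 = 1; there j = 0 forces p = 1. *)
  have [->|tn0] := eqVneq t 0.
    have [j0|jn0] := eqVneq (j%:R : R) 0; last by rewrite powR0// mulr_ge0 ?powR_ge0.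
    have p10 : p - 1 = 0 by apply/eqP; rewrite eq_le -{1}j0 pj; lra.
    by rewrite j0 p10 !powRr0 mulr1.
  have tgt0 : 0 < t by rewrite lt_neqAle eq_sym tn0.
  have -> : j%:R = (p - 1) + (j%:R - (p - 1)) :> R by ring.
  rewrite powRD; last by rewrite tn0 implybT.
  apply: ler_wpM2l; first exact: powR_ge0.
  apply: (@le_trans _ _ (B `^ (j%:R - (p - 1)))).
    by apply: powR_le => //; rewrite subr_ge0.
  by apply: ler_powR => //; lra.
by rewrite mulr_ge0 ?powR_ge0// divr_ge0// exprn_ge0.
Qed.

Lemma measurable_phi d (T : measurableType d) (D : set T) p (f : T -> R) :
  (forall x, D x -> 0 <= f x) -> measurable_fun D f ->
  measurable_fun D (fun x => phi p (f x)).
Proof.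
move=> f0 mf; apply: (@ge0_emeasurable_sum _ _ _ _ (fun j x => coef (f x) j)
  (fun j => p - 1 <= j%:R)) => [j x Dx _|j _]; first by apply: coef_ge0; exact: f0.
apply/measurable_EFinP; apply: measurable_funM => //.
by apply: measurable_funX.
Qed.

(* Comparing the finitely many missing terms x^j / j! with the first one that is kept. *)
Lemma expR_le_phi p : exists2 C, 0 < C & forall t, 1 <= t -> ((expR t)%:E <= C%:E * phi p t)%E.
Proof.
pose n := Num.bound `|p - 1|.
have pn : p - 1 <= n%:R.
  by rewrite (le_trans (ler_norm _))// ltW// archi_boundP.
exists (1 + (n * n`!)%:R); first by rewrite ltr_wpDr.
move=> t t1; have t0 : 0 <= t by exact: le_trans t1.
have tail : (\sum_(n <= j <oo) coef t j <= phi p t)%E.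
  rewrite ereal_series_cond /phi; apply: subset_lee_nneseries => [j _|j].
    exact: coef_ge0.
  by move=> /andP[nj _]; apply: (le_trans pn); rewrite ler_nat.
have head : (coef t n <= phi p t)%E.
  apply: le_trans tail; rewrite (nneseries_split n 1); last by move=> j _; exact: coef_ge0.
  rewrite addn1 big_nat1 leeDl// nneseries_ge0// => j _ _; exact: coef_ge0.
rewrite -eseries_expR// (nneseries_split 0 n); last by move=> j _; exact: coef_ge0.
rewrite add0n addeC EFinD ge0_muleDl ?mul1e; [|by rewrite lee_fin..].
apply: leeD => //.
apply: le_trans (lee_wpmul2l _ head); last by rewrite lee_fin.
have -> : ((n * n`!)%:R%:E * coef t n)%E = (n%:R * t ^+ n)%:E.
  rewrite -EFinM natrM; congr (_%:E); field.
  by rewrite pnatr_eq0 -lt0n fact_gt0.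
rewrite mulr_natl -[n in _ *+ n]subn0 -sumr_const_nat -sumEFin.
rewrite big_nat_cond [leRHS]big_nat_cond; apply: lee_sum => j /andP[/andP[_ jn] _].
rewrite lee_fin; apply: (@le_trans _ _ (t ^+ j)); last by rewrite ler_weXn2l// ltnW.
by rewrite ler_pdivrMr ?ltr0n ?fact_gt0// ler_peMr ?exprn_ge0// ler1n fact_gt0.
Qed.

End phi.

(** * The upper bound *)

Section upper_bound.
Context {R : realType}.
Variables (p theta : R).
Hypotheses (p2 : 2 <= p) (theta0 : 0 <= theta).
Local Notation mu := (@lebesgue_measure R).
Let N := theta + 1.
Let q := p / (p - 1).
(* A bound for v on [R0, oo): v <= 1 somewhere in [r, 2 r], and the oscillation of
   v over that interval is at most the second term. *)
Let osc2 : R := 1 + ((N * ln 2) `^ (p - 1)) `^ p^-1.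

(** The first summand comes from the integral over (0, r0), where r0^N <= 2^N (2 m / d), and the
    second one from the integral beyond [r0]. *)
Definition upper_const : R :=
  2 * 2 `^ N * expR 1 * moser_const p N + expR (osc2 `^ q).

(** [m] is the mass of [v], and [g r s] stands for the energy between [r] and [s] of the function
    that [v] rescales. *)
Variables (k m : R) (v : R -> R) (g : R -> R -> R).
Let d := 1 - k `^ (p - 1).
Hypotheses (k0 : 0 < k) (k1 : k < 1) (m0 : 0 < m).
Hypothesis v0 : forall r, 0 < r -> 0 <= v r.
Hypothesis mv : measurable_fun (`]0, +oo[ : set R) v.
Hypothesis vm : (\int[mu]_(r in `]0%R, +oo[) (v r `^ p * r `^ theta)%:E = m%:E)%E.
Hypothesis g0 : forall r s, 0 < r -> r <= s -> 0 <= g r s.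
Hypothesis gD : forall r s t, 0 < r -> r <= s -> s <= t -> g r s + g s t <= 1.
Hypothesis vg : forall r s, 0 < r -> r <= s ->
  `|v r - v s| `^ p <= k `^ (p - 1) * (g r s * (N * (ln s - ln r)) `^ (p - 1)).

Let p1 : 0 < p - 1. Proof. by move: p2; lra. Qed.
Let p0 : 0 < p. Proof. by move: p2; lra. Qed.
Let N0 : 0 < N. Proof. by rewrite /N; move: theta0; lra. Qed.

Let kp0 : 0 < k `^ (p - 1). Proof. exact: powR_gt0. Qed.
Let kp1 : k `^ (p - 1) < 1.
Proof.
have k1' : 1 \is @Num.nneg R by rewrite nnegrE.
by have := gt0_ltr_powR p1 (ltW k0) k1' k1; rewrite powR1.
Qed.
Let d0 : 0 < d. Proof. by rewrite subr_gt0. Qed.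
Let d1 : d < 1. Proof. by rewrite /d; move: kp0; lra. Qed.

Let g_le1 r s : 0 < r -> r <= s -> g r s <= 1.
Proof.
move=> r0 rs; have := gD r0 rs (lexx s); have := g0 (lt_le_trans r0 rs) (lexx s); lra.
Qed.

Let mass_ge0 r : (0 <= (v r `^ p * r `^ theta)%:E)%E.
Proof. by rewrite lee_fin mulr_ge0// powR_ge0. Qed.

Let m_mass : measurable_fun (`]0, +oo[ : set R) (fun r => (v r `^ p * r `^ theta)%:E).
Proof.
apply/measurable_EFinP; apply: measurable_funM.
  exact: (measurableT_comp (measurable_powR p)).
by apply: measurable_funTS; exact: measurable_powR.
Qed.

(** Otherwise v^p > 2 m / r^N on [r, 2 r], which has length r and weight at least r^theta, and the
    mass would be at least 2 m. *)
Let exists_small_value r : 0 < r -> exists s, [/\ r <= s, s <= 2 * r & v s `^ p * r `^ N <= 2 * m].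
Proof.
move=> r0; apply: contrapT => none.
have h s : r <= s -> s <= 2 * r -> 2 * m / r `^ N < v s `^ p.
  move=> rs s2; rewrite ltr_pdivrMr ?powR_gt0// ltNge; apply/negP => le.
  by apply: none; exists s.
have : ((2 * m)%:E <= m%:E)%E.
rewrite -vm; apply: (@le_trans _ _ (\int[mu]_(s in `[r, (2 * r)%R]) (v s `^ p * s `^ theta)%:E)%E).
    apply: (@le_trans _ _ (\int[mu]_(s in `[r, (2 * r)%R]) (cst (2 * m / r)%:E s))%E).
      rewrite integral_cst; last exact: measurable_itvR.
      rewrite /= lebesgue_measure_itv/= lte_fin ltr_pMl// ltr1n.
      rewrite -EFinB -EFinM lee_fin le_eqVlt; apply/orP; left; apply/eqP.
      by field; rewrite gt_eqF.
    apply: ge0_le_integral => //.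
    - by move=> s _; rewrite lee_fin divr_ge0 ?mulr_ge0 ?(ltW m0) ?(ltW r0).
    - apply: measurable_funS m_mass; first exact: measurable_itvR.
      by move=> s /=; rewrite !in_itv/= andbT => /andP[+ _]; exact: lt_le_trans.
    - move=> s /=; rewrite in_itv/= => /andP[rs s2]; rewrite lee_fin.
      have rN : r `^ N = r `^ theta * r.
        by rewrite /N powRD ?powRr1 ?(ltW r0)//; apply/implyP => _; rewrite gt_eqF.
      have rt : 0 < r `^ theta by exact: powR_gt0.
      apply: (@le_trans _ _ (2 * m / r `^ N * r `^ theta)).
        rewrite rN le_eqVlt; apply/orP; left; apply/eqP; field.
        by rewrite !gt_eqF.
      apply: ler_pM; rewrite ?powR_ge0//.
      + by rewrite divr_ge0 ?powR_ge0// mulr_ge0// ltW.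
      + exact/ltW/h.
      + by apply: powR_le => //; exact: ltW.
  apply: ge0_subset_integral => //.
  by move=> s /=; rewrite !in_itv/= andbT => /andP[+ _]; exact: lt_le_trans.
by rewrite lee_fin; move: m0; lra.
Qed.

Let R0 : R := (2 * m / d) `^ N^-1.

Let R0_gt0 : 0 < R0.
Proof. by rewrite powR_gt0// divr_gt0// mulr_gt0. Qed.

Let R0N : R0 `^ N = 2 * m / d.
Proof.
rewrite /R0 -powRrM mulVf ?powRr1 ?gt_eqF//.
by rewrite ltW// divr_gt0// mulr_gt0.
Qed.

Let small_value r : R0 <= r -> exists s, [/\ r <= s, s <= 2 * r & v s `^ p <= d].
Proof.
move=> R0r; have r0 : 0 < r by exact: lt_le_trans R0r.
have [s [rs s2 h]] := exists_small_value r0; exists s; split => //.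
have vs0 : 0 <= v s by apply: v0; exact: lt_le_trans rs.
have : v s `^ p * R0 `^ N <= 2 * m.
  apply: le_trans h; apply: ler_wpM2l; first exact: powR_ge0.
  by apply: powR_le; [exact: ltW|exact: ltW|].
rewrite R0N -ler_pdivlMr ?divr_gt0 ?mulr_gt0//.
by rewrite invf_div mulrC mulfVK// gt_eqF// mulr_gt0.
Qed.

Let powR_inj_le x y : 0 <= x -> 0 <= y -> x `^ p <= y -> x <= y `^ p^-1.
Proof.
move=> x0 y0 h; have ip : 0 <= p^-1 by rewrite invr_ge0 ltW.
have := powR_le ip (powR_ge0 _ _) h.
by rewrite -powRrM divff ?gt_eqF// powRr1.
Qed.

Let v_bounded r : R0 <= r -> v r <= osc2.
Proof.
move=> R0r; have r0 : 0 < r by exact: lt_le_trans R0r.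
have [s [rs s2 h]] := small_value R0r.
have s0 : 0 < s by exact: lt_le_trans rs.
have vs1 : v s <= 1.
  have := powR_inj_le (v0 s0) ler01; rewrite powR1; apply.
  by apply: (le_trans h); exact: ltW.
have osc : `|v r - v s| <= ((N * ln 2) `^ (p - 1)) `^ p^-1.
  apply: powR_inj_le; rewrite ?powR_ge0//.
  apply: (le_trans (vg r0 rs)).
  have lrs : 0 <= ln s - ln r by rewrite subr_ge0 ler_ln.
  have l2 : ln s - ln r <= ln 2.
    by rewrite lerBlDr -lnM ?posrE// ler_ln// posrE mulr_gt0.
  apply: (@le_trans _ _ (1 * (1 * (N * (ln s - ln r)) `^ (p - 1)))).
    apply: ler_pM; rewrite ?powR_ge0// ?mulr_ge0 ?powR_ge0 ?g0//; first exact: ltW.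
    by apply: ler_wpM2r; [exact: powR_ge0|exact: g_le1].
  rewrite !mul1r; apply: powR_le; [exact: ltW|by rewrite mulr_ge0// ltW|].
  by rewrite ler_pM2l.
by rewrite /osc2; have := ler_norm (v r - v s); lra.
Qed.

Let q_ge0 : 0 <= q. Proof. by rewrite divr_ge0// ltW. Qed.

Let vq_ge0 r : 0 <= v r `^ q. Proof. exact: powR_ge0. Qed.

Let osc2_ge1 : 1 <= osc2.
Proof. by rewrite /osc2 lerDl powR_ge0. Qed.

Let powR_conjugateK x : 0 <= x -> (x `^ q) `^ (p - 1) = x `^ p.
Proof. by move=> x0; rewrite -powRrM /q -mulrA mulVf ?mulr1// gt_eqF. Qed.

Let m_integrand : measurable_fun (`]0, +oo[ : set R)
  (fun r => (phi p (v r `^ q) * (r `^ theta)%:E)%E).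
Proof.
apply: emeasurable_funM.
  apply: measurable_phi => //.
  exact: (measurableT_comp (measurable_powR q)).
apply/measurable_EFinP; apply: measurable_funTS; exact: measurable_powR.
Qed.

Let integrand_ge0 r : (0 <= phi p (v r `^ q) * (r `^ theta)%:E)%E.
Proof. by rewrite mule_ge0 ?phi_ge0// lee_fin powR_ge0. Qed.

Let tail_integral r0 : R0 <= r0 ->
  (\int[mu]_(r in `[r0, +oo[) (phi p (v r `^ q) * (r `^ theta)%:E)
   <= (expR (osc2 `^ q) * m)%:E)%E.
Proof.
move=> Rr0; have r00 : 0 < r0 by exact: lt_le_trans Rr0.
have sub : `[r0, +oo[%classic `<=` (`]0, +oo[%classic : set R).
  by move=> r /=; rewrite !in_itv/= !andbT; exact: lt_le_trans.
rewrite EFinM -vm -ge0_integralZl_EFin ?expR_ge0//.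
apply: (@le_trans _ _ (\int[mu]_(r in `[r0, +oo[)
    ((expR (osc2 `^ q))%:E * (v r `^ p * r `^ theta)%:E))%E).
  apply: ge0_le_integral => //.
  - exact: measurable_funS m_integrand.
  - by apply: measurable_funeM; exact: measurable_funS m_mass.
  move=> r /=; rewrite in_itv/= andbT => rr0.
  have r_gt0 : 0 < r by exact: lt_le_trans rr0.
  rewrite EFinM muleA; apply: lee_wpmul2r; first by rewrite lee_fin powR_ge0.
  (* The factor that [phi_le_powR] extracts from the series is (v^q)^(p - 1) = v^p. *)
  rewrite muleC -EFinM -(powR_conjugateK (v0 r_gt0)).
  apply: phi_le_powR => //; first by move: p2; lra.
    by apply: powR_le => //; [exact: v0|apply: v_bounded; exact: le_trans rr0].
  by have := powR_le q_ge0 ler01 osc2_ge1; rewrite powR1.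
apply: ge0_subset_integral => //.
  exact: measurable_funeM.
by move=> r _; rewrite mule_ge0// lee_fin expR_ge0.
Qed.

Let head_integral r0 : R0 <= r0 -> r0 <= 2 * R0 -> v r0 `^ p <= d ->
  (\int[mu]_(r in `]0%R, r0[) (phi p (v r `^ q) * (r `^ theta)%:E)
   <= (2 * 2 `^ N * expR 1 * moser_const p N * m / d)%:E)%E.
Proof.
move=> Rr0 r02 vr0d; have r00 : 0 < r0 by exact: lt_le_trans Rr0.
(* With this choice c^p k^(p - 1) = 1, which removes k^(p - 1) from the increment bound. *)
pose c := k `^ (- q^-1).
have c0 : 0 <= c by exact: powR_ge0.
pose z r := c * `|v r - v r0|.
have q0 : q != 0 by rewrite mulf_neq0 ?invr_neq0// gt_eqF.
have cp : c `^ p * k `^ (p - 1) = 1.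
  rewrite /c -powRrM -powRD; last by apply/implyP => _; rewrite gt_eqF.
  by rewrite /q invf_div mulNr mulfVK ?gt_eqF// addNr powRr0.
have cq : c `^ q = k^-1.
  by rewrite /c -powRrM mulNr mulVf// powR_inv1// ltW.
have sub : `]0, r0[%classic `<=` (`]0, +oo[%classic : set R).
  by move=> r /=; rewrite !in_itv/= => /andP[->].
have mz : measurable_fun (`]0, r0[ : set R) z.
  apply: measurable_funM => //; apply: measurableT_comp => //.
  by apply: measurable_funB => //; exact: measurable_funS mv.
have zg r s : 0 < r -> r <= s -> s <= r0 ->
    `|z r - z s| `^ p <= g r s * (N * (ln s - ln r)) `^ (p - 1).
  move=> r_gt0 rs _; rewrite -[leRHS]mul1r -[X in _ <= X * _]cp -mulrA /z.
  rewrite -mulrBr normrM (ger0_norm c0) (powRM _ c0 (normr_ge0 _)).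
  apply: ler_wpM2l; first exact: powR_ge0.
  apply: le_trans (vg r_gt0 rs); apply: powR_le; [exact: ltW|exact: normr_ge0|].
  by apply: le_trans (ler_dist_dist _ _) _; rewrite opprB addrA subrK.
have z00 : z r0 = 0 by rewrite /z subrr normr0 mulr0.
have z0 r : 0 < r -> 0 <= z r by move=> _; rewrite mulr_ge0.
have gD' r s : 0 < r -> r <= s -> s <= r0 -> g r s + g s r0 <= 1.
  by move=> r_gt0 rs sr0; exact: gD.
have moser := moser_integral_le p2 N0 r00 z00 z0 mz g0 gD' zg.
(* The sign is read off Moser's inequality, whose left side is nonnegative. *)
have mc0 : 0 <= moser_const p N * r0 `^ N.
  by rewrite -lee_fin; apply: le_trans moser; apply: integral_ge0 => r _;
    rewrite lee_fin mulr_ge0 ?expR_ge0 ?powR_ge0.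
have pointwise r : 0 < r -> v r `^ q <= 1 + z r `^ q.
  move=> r_gt0.
  have q1 : 1 <= q by exact: conjugate_exponent_ge1.
  have vz : v r <= `|v r - v r0| + v r0 by have := ler_norm (v r - v r0); lra.
  apply: le_trans (powR_le q_ge0 (v0 r_gt0) vz) _.
  (* The weight 1 - d = k^(p - 1) gives (1 - d)^(1 - q) = 1 / k = c^q, and v(r0)^p <= d bounds the
     other term by 1. *)
  apply: le_trans (powR_addr_le q1 d0 d1 (normr_ge0 _) (v0 r00)) _.
  rewrite addrC; apply: lerD.
    rewrite one_sub_conjugate//.
    have := powR_conjugate_le p2 (v0 r00) (ltW d0) ler01.
    rewrite powR1 mulr1 => /(_ vr0d); rewrite mulr1 => h.
    apply: le_trans (ler_wpM2l (powR_ge0 _ _) h) _.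
    by rewrite -powRD ?addNr ?powRr0//; apply/implyP => _; rewrite gt_eqF.
  rewrite /z powRM// cq one_sub_conjugate// /d opprB addrC subrK.
  rewrite -powRrM mulrN divff ?gt_eqF// powR_inv1//; exact: ltW.
apply: (@le_trans _ _ (\int[mu]_(r in `]0%R, r0[)
   ((expR 1)%:E * (expR (z r `^ q) * r `^ (N - 1))%:E))%E).
  apply: ge0_le_integral => //.
  - exact: measurable_funS m_integrand.
  - apply: measurable_funeM; apply/measurable_EFinP; apply: measurable_funM.
      by apply: measurableT_comp => //; exact: (measurableT_comp (measurable_powR q)).
    by apply: measurable_funTS; exact: measurable_powR.
  move=> r /=; rewrite in_itv/= => /andP[r_gt0 _].
  rewrite /N addrK EFinM muleA; apply: lee_wpmul2r; first by rewrite lee_fin powR_ge0.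
  apply: (le_trans (phi_le_expR _ (vq_ge0 r))).
  by rewrite -EFinM lee_fin -expRD ler_expR pointwise.
rewrite ge0_integralZl_EFin ?expR_ge0//; last 2 first.
- by move=> r _; rewrite lee_fin mulr_ge0 ?expR_ge0 ?powR_ge0.
- apply/measurable_EFinP; apply: measurable_funM.
    by apply: measurableT_comp => //; exact: (measurableT_comp (measurable_powR q)).
  by apply: measurable_funTS; exact: measurable_powR.
apply: (le_trans (lee_wpmul2l _ moser)); first by rewrite lee_fin expR_ge0.
rewrite -EFinM lee_fin.
have mc : 0 <= moser_const p N.
  by rewrite -(pmulr_lge0 _ (powR_gt0 N r00)).
have r0N : r0 `^ N <= 2 `^ N * (2 * m / d).
  rewrite -R0N -powRM ?(ltW R0_gt0)//; apply: powR_le => //; exact: ltW.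
have := ler_wpM2l (mulr_ge0 (expR_ge0 1) mc) r0N.
by rewrite !mulrA => /le_trans; apply; rewrite le_eqVlt; apply/orP; left; apply/eqP; ring.
Qed.

Lemma upper_core :
  (\int[mu]_(r in `]0%R, +oo[) (phi p (v r `^ q) * (r `^ theta)%:E)
   <= (upper_const / d * m)%:E)%E.
Proof.
have [r0 [Rr0 r02 vr0]] := small_value (lexx R0).
have r00 : 0 < r0 by exact: lt_le_trans Rr0.
have E : `]0, +oo[%classic = `]0, r0[ `|` `[r0, +oo[ :> set R.
  by rewrite -itv_bndbnd_setU// bnd_simp.
have mI := m_integrand; rewrite E in mI.
rewrite E ge0_integral_setU//; last first.
  apply/disj_setPS => r [/=]; rewrite !in_itv/= andbT => /andP[_ rr0].
  by rewrite leNgt rr0.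
apply: (le_trans (leeD (head_integral Rr0 r02 vr0) (tail_integral Rr0))).
rewrite -EFinD lee_fin [leRHS](_ : _ = 2 * 2 `^ N * expR 1 * moser_const p N * m / d +
  expR (osc2 `^ q) / d * m); last by rewrite /upper_const; ring.
rewrite lerD2l; apply: ler_wpM2r; first exact: ltW.
by rewrite ler_pdivlMr// ger_pMr ?expR_gt0// ltW.
Qed.

End upper_bound.

(** * The Gamma function *)

Section gamma.
Context {R : realType}.
Implicit Types (a p x c r s : R).
Local Notation mu := (@lebesgue_measure R).

(** The inequality y <= e^y at y = c x / p, raised to the power p. *)
Lemma powR_le_expR p c x : 0 < p -> 0 < c -> 0 <= x -> x `^ p <= (p / c) `^ p * expR (c * x).
Proof.
move=> p0 c0 x0.
have -> : expR (c * x) = (expR (c * x / p)) `^ p.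
  by rewrite -expRM mulrC mulfVK// gt_eqF.
have pc0 : 0 <= p / c by rewrite divr_ge0// ltW.
rewrite -powRM ?expR_ge0//; apply: powR_le => //; first exact: ltW.
have h := expR_ge1Dx (c * x / p).
rewrite [leLHS](_ : x = p / c * (c * x / p)); last by field; rewrite !gt_eqF.
by apply: ler_wpM2l => //; lra.
Qed.

Lemma integral_itvcc_powR a r s : 0 < a -> 0 < r -> r <= s ->
  (\int[mu]_(x in `[r, s]) (x `^ (a - 1))%:E = ((s `^ a - r `^ a) / a)%:E)%E.
Proof.
move=> a0 r0; rewrite le_eqVlt => /predU1P[<-|rs].
  by rewrite set_itv1 integral_set1 subrr mul0r.
have pos x : x \in `[r, s] -> 0 < x.
  by rewrite in_itv/= => /andP[rx _]; exact: lt_le_trans rx.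
have dp b x : 0 < x -> derivable (@powR R ^~ b) x 1.
  by move=> x0; apply: derivable_powR; rewrite in_itv/= andbT.
have cp b x : 0 < x -> {for x, continuous (@powR R ^~ b)}.
  by move=> x0; apply: differentiable_continuous; apply/derivable1_diffP; exact: dp.
rewrite (@continuous_FTC2 R (fun x => x `^ (a - 1)) (fun x => x `^ a / a) r s)//.
- by rewrite -EFinB mulrBl.
- by apply: continuous_in_subspaceT => x /set_mem xrs; apply: cp; exact: pos.
- split.
  + move=> x /subset_itv_oo_cc /pos x0; apply: derivableM => //; exact: dp.
  + by apply: cvg_at_right_filter; apply: cvgMr_tmp; exact: cp.
  + by apply: cvg_at_left_filter; apply: cvgMr_tmp; apply: cp; exact: lt_trans rs.
- move=> x /subset_itv_oo_cc /pos x0; rewrite derive1E deriveM//; last exact: dp.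
  rewrite derive_cst scaler0 add0r -derive1E powR_derive1 ?in_itv/= ?andbT//.
  by rewrite /GRing.scale/= mulrA mulVf ?mul1r// gt_eqF.
Qed.
Lemma measurable_powR_on (D : set R) a : measurable_fun D (@powR R ^~ a).
Proof. by apply: measurable_funTS; exact: measurable_powR. Qed.

(** Monotone limit of the integrals over [1 / (n + 1), 1], which avoid the singularity at 0. *)
Lemma integral_oc01_powR_le a : 0 < a ->
  (\int[mu]_(x in `]0%R, 1%R]) (x `^ (a - 1))%:E <= a^-1%:E)%E.
Proof.
move=> a0; pose F n := `[n.+1%:R^-1, 1]%classic : set R.
have UF : \bigcup_n F n = `]0, 1]%classic.
  apply/seteqP; split => [x [n _]|x].
    by rewrite /F /= !in_itv/= => /andP[x0 ->]; rewrite (lt_le_trans _ x0).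
  rewrite /= in_itv/= => /andP[x0 x1].
  have [n hn] : exists n, x^-1 <= n%:R.
    by exists (Num.bound x^-1); rewrite ltW// archi_boundP// invr_ge0 ltW.
  exists n => //; rewrite /F/= in_itv/= x1 andbT invf_ple ?posrE//.
  by rewrite (le_trans hn)// ler_nat.
have ndF : nondecreasing_seq F.
  move=> n m nm; apply/subsetPset => x; rewrite /F/= !in_itv/= => /andP[xn ->].
  by rewrite andbT (le_trans _ xn)// lef_pV2 ?posrE// ler_nat ltnS.
have cv : (\int[mu]_(x in F n) (x `^ (a - 1))%:E @[n --> \oo] -->
    \int[mu]_(x in \bigcup_n F n) (x `^ (a - 1))%:E)%E.
  apply: ge0_nondecreasing_set_cvg_integral => //.
  - by move=> n; exact: measurable_itvR.
  - by move=> n; apply/measurable_EFinP; exact: measurable_powR_on.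
  - by move=> n x _; rewrite lee_fin powR_ge0.
rewrite -UF.
rewrite -(cvg_lim _ cv)//; apply: lime_le; first exact: cvgP cv.
apply: nearW => n; rewrite integral_itvcc_powR//; last by rewrite invf_le1// ler1n.
rewrite lee_fin powR1 ler_pdivrMr// mulVf ?gt_eqF// gerBl.
Qed.

Lemma Gamma_gt0 a : 0 < a -> 0 < Gamma a.
Proof.
move=> a0; pose f x : \bar R := (x `^ (a - 1) * expR (- x))%:E.
have f0 x : (0 <= f x)%E by rewrite lee_fin mulr_ge0 ?powR_ge0 ?expR_ge0.
have mf (D : set (measurableTypeR R)) : measurable_fun D f.
  apply/measurable_EFinP; apply: measurable_funM; first exact: measurable_powR_on.
  by apply: measurableT_comp => //; exact: measurableT_comp.
rewrite (_ : Gamma a = fine (\int[mu]_(x in `]0%R, +oo[) f x)%E)//.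
(* [fine] sends infinity to 0, so finiteness is needed as well as positivity. *)
apply: fine_gt0; apply/andP; split.
  apply: (@lt_le_trans _ _ (\int[mu]_(x in `[1%R, 2%R]) (cst (2^-1 * expR (- 2))%:E x))%E).
    rewrite integral_cst; last exact: measurable_itvR.
    rewrite /= lebesgue_measure_itv/= lte_fin ltr1n/= -EFinB -EFinM lte_fin.
    by rewrite !mulr_gt0 ?expR_gt0// ?invr_gt0//; lra.
  apply: (@le_trans _ _ (\int[mu]_(x in `[1%R, 2%R]) f x)%E).
    apply: ge0_le_integral => //; first by move=> x _; rewrite lee_fin mulr_ge0 ?expR_ge0.
    move=> x /=; rewrite in_itv/= => /andP[x1 x2]; rewrite lee_fin.
    apply: ler_pM; rewrite ?expR_ge0//; last by rewrite ler_expR; lra.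
    apply: (@le_trans _ _ (x `^ (- 1))); last by apply: ler_powR => //; lra.
    by rewrite powR_inv1 ?lef_pV2 ?posrE//; lra.
  apply: ge0_subset_integral => //.
  by move=> x /=; rewrite !in_itv/= andbT => /andP[+ _]; exact: lt_le_trans.
have E : `]0, +oo[%classic = `]0, 1] `|` `]1, +oo[ :> set R.
  by rewrite -itv_bndbnd_setU// bnd_simp.
rewrite E ge0_integral_setU//; last first.
  by apply/disj_setPS => x [/=]; rewrite !in_itv/= andbT => /andP[_ +]; rewrite leNgt => /negbTE ->.
apply: lte_add_pinfty.
  apply: (@le_lt_trans _ _ (\int[mu]_(x in `]0%R, 1%R]) (x `^ (a - 1))%:E)%E).
    apply: ge0_le_integral => //.
    - by apply/measurable_EFinP; exact: measurable_powR_on.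
    - move=> x /=; rewrite in_itv/= => /andP[x0 _]; rewrite lee_fin ler_piMr ?powR_ge0//.
      by rewrite expR_le1 oppr_le0 ltW.
  by apply: le_lt_trans (integral_oc01_powR_le a0) _; rewrite ltry.
(* By x^a <= (2 a)^a e^(x / 2), the integrand is at most [c] times the exponential density of rate 1
   / 2; the factor 2 cancels the rate. *)
pose c := (a / 2^-1) `^ a * 2.
have c0 : 0 <= c by rewrite mulr_ge0 ?powR_ge0.
have mpdf := measurable_exponential_pdf (2^-1 : R).
apply: (@le_lt_trans _ _ (\int[mu]_x (c%:E * (exponential_pdf 2^-1 x)%:E))%E); last first.
  rewrite ge0_integralZl_EFin//.
  - by rewrite integral_exponential_pdf ?mule1 ?ltry.
  - by move=> x _; rewrite lee_fin exponential_pdf_ge0.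
  - exact/measurable_EFinP.
apply: (@le_trans _ _ (\int[mu]_(x in `]1%R, +oo[) (c%:E * (exponential_pdf 2^-1 x)%:E))%E).
  apply: ge0_le_integral => //.
    by apply: measurable_funeM; apply/measurable_EFinP; exact: measurable_funTS.
  move=> x /=; rewrite in_itv/= andbT => x1.
  have x0 : 0 <= x by lra.
  rewrite exponential_pdfE// -EFinM lee_fin.
  apply: (@le_trans _ _ (x `^ a * expR (- x))).
    by apply: ler_wpM2r; [exact: expR_ge0|apply: ler_powR; lra].
  have h : 0 < (2^-1 : R) by rewrite invr_gt0.
  apply: le_trans (ler_wpM2r (expR_ge0 _) (powR_le_expR a0 h x0)) _.
  rewrite /c -!mulrA; apply: ler_wpM2l; first exact: powR_ge0.
  rewrite mulrA divff ?mul1r; last by rewrite pnatr_eq0.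
  by rewrite -expRD ler_expR; lra.
apply: ge0_subset_integral => //.
- by apply: measurable_funeM; exact/measurable_EFinP.
- by move=> x _; rewrite -EFinM lee_fin mulr_ge0// exponential_pdf_ge0.
Qed.

Lemma omega_gt0 a : 0 <= a -> 0 < omega a.
Proof.
move=> a0; rewrite /omega divr_gt0 ?mulr_gt0 ?powR_gt0 ?pi_gt0//.
by apply: Gamma_gt0; lra.
Qed.

End gamma.

(** * Moser's functions *)

Section moser_functions.
Context {R : realType}.
Local Notation mu := (@lebesgue_measure R).

Lemma ln_increment_le (x y : R) : 0 < x -> x <= y -> ln y - ln x <= (y - x) / x.
Proof.
move=> x0 xy; have y0 : 0 < y by exact: lt_le_trans xy.
rewrite -ln_div ?posrE//.
have -> : y / x = 1 + (y - x) / x by field; rewrite gt_eqF.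
by apply: le_ln1Dx; rewrite (lt_le_trans (ltrN10 R))// divr_ge0 ?subr_ge0// ltW.
Qed.

Variables (p theta c L : R).
Hypotheses (p2 : 2 <= p) (theta0 : 0 <= theta) (c0 : 0 < c) (L0 : 0 < L).
Let N := theta + 1.
Let b := expR (- L / N).

(** Equal to c L up to the radius [b] where - N ln r = L, to - c N ln r on [b, 1], and to 0 beyond;
    the amplitude [c] will be fixed by the energy. *)
Definition moser_fun (r : R) : R := c * clamp 0 L (- (N * ln r)).
Local Notation u := moser_fun.

Let N0 : 0 < N. Proof. by rewrite /N; move: theta0; lra. Qed.
Let b0 : 0 < b. Proof. exact: expR_gt0. Qed.
Let b1 : b < 1. Proof. by rewrite expR_lt1 mulNr oppr_lt0 divr_gt0. Qed.
Let lnb : N * ln b = - L.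
Proof. by rewrite expRK mulrC mulfVK// gt_eqF. Qed.

Lemma moser_fun_ge0 r : 0 <= u r.
Proof. by rewrite mulr_ge0 ?clamp_ge// ltW. Qed.

Lemma moser_fun_inner r : 0 < r -> r <= expR (- L / N) -> u r = c * L.
Proof.
move=> r0 rb; rewrite /u /clamp.
have : N * ln r <= N * ln b by rewrite ler_pM2l// ler_ln.
rewrite lnb lerNr => h.
by rewrite max_r ?min_l// (le_trans _ h)// ltW.
Qed.

Let moser_fun_middle r : b <= r -> r <= 1 -> u r = c * (- (N * ln r)).
Proof.
move=> br r1; have r0 : 0 < r by exact: lt_le_trans br.
rewrite /u clamp_id//; first by rewrite oppr_ge0 pmulr_rle0// ln_le0.
by rewrite lerNl -lnb ler_pM2l// ler_ln.
Qed.

Let moser_fun_outer r : 1 <= r -> u r = 0.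
Proof.
move=> r1; rewrite /u /clamp max_l; last by rewrite oppr_le0 mulr_ge0 ?ln_ge0// ltW.
by rewrite min_r ?mulr0// ltW.
Qed.

(** Truncation does not increase the increments of the logarithm, so the function is Lipschitz
    beyond [a1] with constant c N / a1. *)
Lemma moser_fun_locally_ac : locally_absolutely_continuous u.
Proof.
move=> a1 a2 a0 _ e e0.
have K0 : 0 < c * N / a1 by rewrite !divr_gt0// mulr_gt0.
exists (e / (c * N / a1)); first by rewrite divr_gt0.
move=> n x y xy _; rewrite ltr_pdivlMr//; apply: le_lt_trans.
rewrite mulr_suml; apply: ler_sum => i _; have [ax [xyi _]] := xy i.
have x0 : 0 < x i by exact: lt_le_trans ax.
have lxy : N * ln (x i) <= N * ln (y i).
  by rewrite ler_pM2l// ler_ln// posrE (lt_le_trans x0).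
have nlxy : - (N * ln (y i)) <= - (N * ln (x i)) by rewrite lerN2.
rewrite /u -mulrBr normrM gtr0_norm// distrC ger0_norm; last first.
  by rewrite subr_ge0 clamp_nondecreasing.
apply: (@le_trans _ _ (c * (N * ((y i - x i) / a1)))); last first.
  by rewrite le_eqVlt; apply/orP; left; apply/eqP; ring.
apply: ler_wpM2l; first exact: ltW.
apply: le_trans (clamp_distr 0 L nlxy) _.
rewrite opprK addrC -mulrBr; apply: ler_wpM2l; first exact: ltW.
apply: le_trans (ln_increment_le x0 xyi) _.
apply: ler_wpM2l; first by rewrite subr_ge0.
by rewrite lef_pV2 ?posrE.
Qed.

Lemma moser_fun_cvg0 : u r @[r --> +oo] --> 0.
Proof.
apply: cvg_near_cst; near=> r; apply/eqP; rewrite moser_fun_outer//.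
Unshelve. all: by end_near. Qed.

Lemma measurable_moser_fun D : measurable_fun D u.
Proof.
apply: measurable_funM => //; apply: measurable_minr => //; apply: measurable_maxr => //.
apply: measurableT_comp => //; apply: measurable_funM => //.
by apply: measurable_funTS; exact: measurable_ln.
Qed.

Let derive_inner r : 0 < r -> r < b -> u^`()%classic r = 0.
Proof.
move=> r0 rb; rewrite derive1E (@near_eq_derive _ _ _ _ (cst (c * L))) ?derive_cst//.
have : \forall z \near r, z \in `]0, b[ by apply: near_in_itvoo; rewrite in_itv/= r0.
by apply: filterS => z; rewrite in_itv/= => /andP[z0 /ltW zb]; rewrite moser_fun_inner.
Qed.

Let derive_middle r : b < r -> r < 1 -> u^`()%classic r = - (c * N) / r.
Proof.
move=> br r1; have r0 : 0 < r by exact: lt_trans br.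
rewrite derive1E (@near_eq_derive _ _ _ _ (fun z => - (c * N) *: (ln z : R^o))).
  have [dl dlE] := is_derive1_ln r0.
  by rewrite deriveZ// dlE.
have : \forall z \near r, z \in `]b, 1[ by apply: near_in_itvoo; rewrite in_itv/= br.
apply: filterS => z; rewrite in_itv/= => /andP[/ltW bz /ltW z1].
by rewrite moser_fun_middle// /GRing.scale/=; ring.
Qed.

Let derive_outer r : 1 < r -> u^`()%classic r = 0.
Proof.
move=> r1; rewrite derive1E (@near_eq_derive _ _ _ _ (cst 0)) ?derive_cst//.
have : \forall z \near r, z \in `]1, r + 1[.
  by apply: near_in_itvoo; rewrite in_itv/= r1 ltrDl/=.
by apply: filterS => z; rewrite in_itv/= => /andP[/ltW z1 _]; rewrite moser_fun_outer.
Qed.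

(** The kinks [b] and 1 are singled out: the derivative is not computed there, and any function is
    measurable on a point. *)
Let pos_split : `]0, +oo[%classic =
  (`]0, b[ `|` [set b]) `|` (`]b, 1[ `|` [set 1]) `|` `]1, +oo[ :> set R.
Proof.
apply/seteqP; split => r.
  rewrite /= in_itv/= andbT => r0; rewrite !in_itv/= r0/= andbT.
  have [rb|br|->] := ltgtP r b; [by left; left; left| |by left; left; right].
  by have [r1|r1|->] := ltgtP r 1; [left; right; left|right|left; right; right].
rewrite /= !in_itv/= !andbT => -[[[/andP[]//|->//]|[/andP[br _]|->]]|r1] //.
  exact: lt_trans br.
exact: lt_trans r1.
Qed.

Lemma measurable_derive_moser_fun : measurable_fun (`]0, +oo[ : set R) (u^`()%classic).
Proof.
have m1 (x : R) : measurable ([set x] : set (measurableTypeR R)) by exact: measurable_set1.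
rewrite pos_split; apply/measurable_funU => //.
  by do ?apply: measurableU => //; exact: measurable_itvR.
split.
  apply/measurable_funU => //; try by apply: measurableU => //; exact: measurable_itvR.
  split; apply/measurable_funU => //; try exact: measurable_itvR.
    split; last exact: measurable_fun_set1.
    apply: (@eq_measurable_fun _ _ _ _ _ (fun _ : R => 0 : R)) => // r /set_mem/=.
    by rewrite in_itv/= => /andP[r0 rb]; rewrite derive_inner.
  split; last exact: measurable_fun_set1.
  apply: (@eq_measurable_fun _ _ _ _ _ (fun r : R => - (c * N) * r^-1 : R)).
    by move=> r /set_mem/=; rewrite in_itv/= => /andP[br r1]; rewrite derive_middle.
  apply: measurable_funM => //; apply: measurable_inv_pos; last exact: measurable_itvR.
  by move=> r /=; rewrite !in_itv/= andbT => /andP[br _]; exact: lt_trans br.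
apply: (@eq_measurable_fun _ _ _ _ _ (fun _ : R => 0 : R)) => // r /set_mem/=.
by rewrite in_itv/= andbT => r1; rewrite derive_outer.
Qed.

(** Away from the kinks the integrand is (c N)^p / r on (b, 1) and 0 elsewhere, and 1 / r has
    integral L / N over (b, 1). *)
Lemma moser_fun_energy :
  (\int[mu]_(r in `]0%R, +oo[) (`|u^`()%classic r| `^ p * r `^ (p - 1))%:E =
   (c `^ p * N `^ (p - 1) * L)%:E)%E.
Proof.
have p0 : 0 < p by move: p2; lra.
have mpos : measurable (`]0, +oo[%classic : set (measurableTypeR R)) by exact: measurable_itvR.
have bpos : `]b, 1[ `<=` (`]0, +oo[%classic : set R).
  by move=> r /=; rewrite !in_itv/= andbT => /andP[br _]; exact: lt_trans br.
have minv : measurable_fun (`]b, 1[ : set R) (fun r => ((c * N) `^ p)%:E * (r^-1)%:E)%E.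
  apply: measurable_funeM; apply/measurable_EFinP.
  by apply: measurable_inv_pos => //; exact: measurable_itvR.
transitivity (\int[mu]_(r in `]0%R, +oo[)
    ((fun r => ((c * N) `^ p)%:E * (r^-1)%:E) \_ `]b, 1%R[) r)%E.
  apply: ge0_ae_eq_integral => //.
  - apply/measurable_EFinP; apply: measurable_funM; last exact: measurable_powR_on.
    exact: measurable_norm_powR measurable_derive_moser_fun.
  - by apply/measurable_restrict => //; exact: measurable_funS minv.
  - by move=> r _; rewrite lee_fin mulr_ge0 ?powR_ge0.
  - move=> r _; rewrite patchE; case: ifPn => // /set_mem/bpos/=.
    by rewrite in_itv/= andbT => r0; rewrite mule_ge0// lee_fin ?powR_ge0// invr_ge0 ltW.
  exists ([set b] `|` [set 1]); split.
  - by apply: measurableU; exact: measurable_set1.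
  - have nn (x : R) : mu.-negligible [set x].
      apply/negligibleP; first exact: measurable_set1.
      exact: lebesgue_measure_set1.
    have /negligibleP := negligibleU (nn b) (nn 1); apply.
    by apply: measurableU; exact: measurable_set1.
  move=> r /= /not_implyP[]; rewrite in_itv/= andbT => r0.
  rewrite patchE; apply: contra_notP => /not_orP[rb r1].
  have [{}rb|br|//] := ltgtP r b.
    rewrite memNset ?derive_inner ?normr0 ?powR0 ?mul0r ?gt_eqF//.
    by rewrite /= in_itv/= ltNge (ltW rb).
  have [{}r1|{}r1|//] := ltgtP r 1.
    rewrite mem_set ?derive_middle//=; last by rewrite in_itv/= br.
    rewrite -EFinM; congr (_%:E).
    rewrite mulNr normrN ger0_norm; last by rewrite divr_ge0 ?mulr_ge0// ltW.
    have cN0 : 0 <= c * N by rewrite mulr_ge0// ltW.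
    have ir0 : 0 <= r^-1 by rewrite invr_ge0 ltW.
    rewrite (powRM p cN0 ir0) -[LHS]mulrA; congr (_ * _).
    rewrite -(powR_inv1 (ltW r0)) -powRrM -powRD; last by apply/implyP => _; rewrite gt_eqF.
    by congr (_ `^ _); ring.
  rewrite memNset ?derive_outer ?normr0 ?powR0 ?mul0r ?gt_eqF//.
  by rewrite /= in_itv/= (ltNge r) (ltW r1) andbF.
rewrite -integral_mkcondr setIidr//.
rewrite ge0_integralZl_EFin ?powR_ge0//; last 2 first.
- by move=> r /bpos/=; rewrite in_itv/= andbT lee_fin invr_ge0 => /ltW.
- by apply/measurable_EFinP; apply: measurable_inv_pos => //; exact: measurable_itvR.
rewrite integral_itvoo_inv//; last exact: ltW.
rewrite ln1 sub0r expRK -EFinM; congr (_%:E).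
rewrite powRM ?(ltW c0) ?(ltW N0)// -[in LHS](mulr_powRB1 (ltW N0) p0).
by field; rewrite gt_eqF.
Qed.

(** Dropping the truncation makes the bound independent of [L]: (- N ln r)^p <= (2 p)^p r^(- N / 2),
    and r^(N / 2 - 1) has integral at most 2 / N over (0, 1). *)
Lemma moser_fun_mass :
  (\int[mu]_(r in `]0%R, +oo[) (u r `^ p * r `^ theta)%:E <=
   (c `^ p * ((2 * p) `^ p * (2 / N)))%:E)%E.
Proof.
have p0 : 0 < p by move: p2; lra.
have m1 : measurable (`]0, 1]%classic : set (measurableTypeR R)) by exact: measurable_itvR.
have E : `]0, +oo[%classic = `]0, 1] `|` `]1, +oo[ :> set R.
  by rewrite -itv_bndbnd_setU// bnd_simp.
have mf D : measurable_fun D (fun r => (u r `^ p * r `^ theta)%:E).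
  apply/measurable_EFinP; apply: measurable_funM; last exact: measurable_powR_on.
  by apply: (measurableT_comp (measurable_powR p)); exact: measurable_moser_fun.
rewrite E ge0_integral_setU//; last 2 first.
- by move=> r _; rewrite lee_fin mulr_ge0 ?powR_ge0.
- by apply/disj_setPS => x [/=]; rewrite !in_itv/= andbT => /andP[_ +]; rewrite leNgt => /negbTE ->.
rewrite [X in (_ + X)%E](_ : _ = 0%E) ?adde0; last first.
  rewrite (@eq_integral _ _ _ _ _ (cst 0%E)) ?integral0// => r /set_mem/=.
  rewrite in_itv/= andbT => r1; rewrite moser_fun_outer ?(ltW r1)//.
  by rewrite powR0 ?mul0r// gt_eqF.
have N2 : 0 < N / 2 by rewrite divr_gt0.
apply: (@le_trans _ _ (\int[mu]_(r in `]0%R, 1%R])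
   ((c `^ p * (2 * p) `^ p)%:E * (r `^ (N / 2 - 1))%:E))%E).
  apply: ge0_le_integral => //.
  - by move=> r _; rewrite lee_fin mulr_ge0 ?powR_ge0.
  - exact: mf.
  - by apply: measurable_funeM; apply/measurable_EFinP; exact: measurable_powR_on.
  move=> r /=; rewrite in_itv/= => /andP[r0 r1].
  have l0 : 0 <= - (N * ln r) by rewrite oppr_ge0 pmulr_rle0// ln_le0.
  have h2 : 0 < (2^-1 : R) by rewrite invr_gt0.
  have h := powR_le_expR p0 h2 l0.
  rewrite -EFinM lee_fin /u powRM ?clamp_ge ?(ltW c0) ?(ltW L0)// -!mulrA.
  apply: ler_wpM2l; first exact: powR_ge0.
  apply: (@le_trans _ _ ((- (N * ln r)) `^ p * r `^ theta)).
    apply: ler_wpM2r; first exact: powR_ge0.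
    apply: powR_le; [exact: ltW|by rewrite clamp_ge// ltW|].
    by rewrite /clamp ge_min (max_r l0) lexx orbT.
  apply: le_trans (ler_wpM2r (powR_ge0 _ _) h) _.
  rewrite invrK -mulrA (mulrC p); apply: ler_wpM2l; first exact: powR_ge0.
  rewrite /powR gt_eqF// -expRD ler_expR le_eqVlt; apply/orP; left; apply/eqP.
  by rewrite /N; field.
rewrite ge0_integralZl_EFin//; last 3 first.
- by move=> r _; rewrite lee_fin powR_ge0.
- by apply/measurable_EFinP; exact: measurable_powR_on.
- by rewrite mulr_ge0 ?powR_ge0.
apply: le_trans (lee_wpmul2l _ (integral_oc01_powR_le N2)) _.
  by rewrite lee_fin mulr_ge0 ?powR_ge0.
by rewrite -EFinM lee_fin invf_div mulrA.
exact: mf.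
Qed.

(** Only [b / 2, b] is kept, where u = c L; the least weight (b / 2)^theta times the length b / 2 is
    e^(-L) / 2^N. *)
Lemma moser_fun_exp_integral m : 0 <= m ->
  (phi p (m * (c * L) `^ (p / (p - 1))) * (expR (- L) / 2 `^ N)%:E <=
   \int[mu]_(r in `]0%R, +oo[) (phi p (m * u r `^ (p / (p - 1))) * (r `^ theta)%:E))%E.
Proof.
move=> m0.
set q := p / (p - 1).
have t0 r : 0 <= m * u r `^ q by rewrite mulr_ge0 ?powR_ge0.
have C0 : (0 <= phi p (m * (c * L) `^ q))%E by rewrite phi_ge0// mulr_ge0 ?powR_ge0.
have mf : measurable_fun (`]0, +oo[ : set R) (fun r => (phi p (m * u r `^ q) * (r `^ theta)%:E)%E).
  apply: emeasurable_funM; last by apply/measurable_EFinP; exact: measurable_powR_on.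
  apply: measurable_phi => //; apply: measurable_funM => //.
  by apply: (measurableT_comp (measurable_powR q)); exact: measurable_moser_fun.
have b2 : b / 2 <= b by rewrite ler_pdivrMr//; move: b0; lra.
have sub : `[b / 2, b] `<=` (`]0, +oo[%classic : set R).
  move=> r /=; rewrite !in_itv/= andbT => /andP[br _]; apply: lt_le_trans br.
  by rewrite divr_gt0.
apply: (@le_trans _ _ (\int[mu]_(r in `[(b / 2)%R, b])
   (phi p (m * u r `^ q) * (r `^ theta)%:E))%E); last first.
  apply: ge0_subset_integral => //.
  by move=> r _; rewrite mule_ge0 ?phi_ge0// lee_fin powR_ge0.
apply: (@le_trans _ _ (\int[mu]_(r in `[(b / 2)%R, b])
   (cst (phi p (m * (c * L) `^ q) * ((b / 2) `^ theta)%:E) r))%E); last first.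
  apply: ge0_le_integral => //.
  - by move=> r _; rewrite mule_ge0// lee_fin powR_ge0.
  - exact: measurable_funS mf.
  move=> r rb; have /= := sub _ rb; rewrite in_itv/= andbT => r0.
  move: rb; rewrite /= in_itv/= => /andP[br rb].
  rewrite moser_fun_inner//; apply: lee_wpmul2l => //.
  by rewrite lee_fin; apply: powR_le => //; rewrite divr_ge0// ltW.
rewrite integral_cst; last exact: measurable_itvR.
rewrite /= lebesgue_measure_itv/= lte_fin ltr_pdivrMr// ltr_pMr// ltr1n -EFinB.
rewrite -muleA -EFinM; apply: lee_wpmul2l => //; rewrite lee_fin.
have -> : b - b / 2 = b / 2 by field.
have b20 : 0 < b / 2 by rewrite divr_gt0.
rewrite -{2}(powRr1 (ltW b20)) -powRD; last by apply/implyP => _; rewrite gt_eqF.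
rewrite -/N powRM ?(ltW b0) ?invr_ge0//.
have -> : b `^ N = expR (- L) by rewrite /b -expRM mulfVK// gt_eqF.
by rewrite -[2^-1 in leRHS]powR_inv1// -powRrM mulN1r powRN.
Qed.

End moser_functions.

(** * Conclusion *)

Section assembly.
Context {R : realType}.
Variables (p theta : R).
Hypotheses (p2 : 2 <= p) (theta0 : 0 <= theta).
Local Notation mu := (@lebesgue_measure R).
Let N := theta + 1.
Let q := p / (p - 1).
Let mc := mu_crit (p - 1) theta.
Let Wa := omega (p - 1).
Let Wt := omega theta.

Let p1 : 0 < p - 1. Proof. by move: p2; lra. Qed.
Let p0 : 0 < p. Proof. by move: p2; lra. Qed.
Let N0 : 0 < N. Proof. by rewrite /N; move: theta0; lra. Qed.
Let Wa0 : 0 < Wa. Proof. exact/omega_gt0/ltW. Qed.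
Let Wt0 : 0 < Wt. Proof. exact: omega_gt0. Qed.

(** This is why [mu_crit] is critical: rescaling u by mu_crit^(1/q) gives an increment bound with
    constant 1 in the variable N ln r, the energy including its factor [omega]. *)
Let mcE : mc `^ (p - 1) = N `^ (p - 1) * Wa.
Proof.
rewrite /mc /mu_crit powRM ?powR_ge0 ?(ltW N0)// -powRrM mulVf ?gt_eqF// powRr1//.
exact: ltW.
Qed.

Lemma mu_crit_gt0 : 0 < mc.
Proof. by rewrite /mc /mu_crit mulr_gt0// powR_gt0. Qed.

Lemma Lqnorm_powR a (u : R -> R) : 0 <= a ->
  (Lqnorm a p u `^ p =
   (omega a)%:E * \int[mu]_(r in `]0%R, +oo[) (`|u r| `^ p * r `^ a)%:E)%E.
Proof.
move=> a0; rewrite /Lqnorm -poweRrM mulVf ?gt_eqF// poweRe1.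
  by congr (_ * _)%E; apply: eq_integral => r _; rewrite EFinM.
rewrite mule_ge0// ?lee_fin ?(ltW (omega_gt0 a0))//.
by apply: integral_ge0 => r _; rewrite mule_ge0// lee_fin powR_ge0.
Qed.

(** By continuity |u| stays above |u(r1)| / 2 on a short interval to the right of [r1]. *)
Lemma mass_gt0 (u : R -> R) r1 : locally_absolutely_continuous u ->
  measurable_fun (`]0, +oo[ : set R) u -> 0 < r1 -> u r1 != 0 ->
  (0 < \int[mu]_(r in `]0%R, +oo[) (`|u r| `^ p * r `^ theta)%:E)%E.
Proof.
move=> acu mu_ r10 ur1.
have n0 : 0 < `|u r1| / 2 by rewrite divr_gt0// normr_gt0.
have r1l : r1 <= r1 + 1 by rewrite lerDl.
have lac := list_ac_absolutely_continuous (acu r1 (r1 + 1) r10 r1l).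
have [d d0 H] := list_ac_continuous lac n0.
pose s := Num.min (d / 2) 1.
have s0 : 0 < s by rewrite lt_min divr_gt0//=.
have sd : s < d by rewrite /s gt_min; apply/orP; left; rewrite ltr_pdivrMr// ltr_pMr// ltr1n.
have s1 : s <= 1 by rewrite /s ge_min lexx orbT.
have mf : measurable_fun (`]0, +oo[ : set R) (fun r => (`|u r| `^ p * r `^ theta)%:E).
  apply/measurable_EFinP; apply: measurable_funM; last exact: measurable_powR_on.
  exact: measurable_norm_powR.
have sub : `[r1, r1 + s] `<=` (`]0, +oo[%classic : set R).
  by move=> r /=; rewrite !in_itv/= andbT => /andP[+ _]; exact: lt_le_trans.
have r1s : r1 < r1 + s by rewrite ltrDl.
apply: (@lt_le_trans _ _ (\int[mu]_(r in `[r1, (r1 + s)%R])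
   (cst ((`|u r1| / 2) `^ p * r1 `^ theta)%:E r))%E).
  rewrite integral_cst; last exact: measurable_itvR.
  rewrite /= lebesgue_measure_itv/= lte_fin r1s -EFinB -EFinM lte_fin.
  by rewrite !mulr_gt0 ?powR_gt0// subr_gt0.
apply: (@le_trans _ _ (\int[mu]_(r in `[r1, (r1 + s)%R]) (`|u r| `^ p * r `^ theta)%:E)%E).
  apply: ge0_le_integral => //.
  - by move=> r _; rewrite lee_fin mulr_ge0 ?powR_ge0.
  - exact: measurable_funS mf.
  move=> r /=; rewrite in_itv/= => /andP[r1r rs]; rewrite lee_fin.
  have ur : `|u r1| / 2 <= `|u r|.
    have rr : r - r1 < d by rewrite ltrBlDl (le_lt_trans rs)// ltrD2l.
    have r1le : r <= r1 + 1 by rewrite (le_trans rs)// lerD2l.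
    have := H r1 r (lexx _) r1r r1le rr; rewrite distrC => h.
    have := ler_distD (u r) (u r1) 0; rewrite !subr0; lra.
  apply: ler_pM; rewrite ?powR_ge0//; apply: powR_le; rewrite ?(ltW p0) ?(ltW n0)//.
  exact: ltW.
apply: ge0_subset_integral => //.
by move=> r _; rewrite lee_fin mulr_ge0 ?powR_ge0.
Qed.

Lemma upper_const_gt0 : 0 < upper_const p theta.
Proof.
have e2 : 2 * expR (-1) < 1 :> R.
  rewrite expRN -ltr_pdivlMr ?invr_gt0 ?expR_gt0// div1r invrK.
  by have := expR_gt1Dx (oner_neq0 R); lra.
have gap0 : 0 <= moser_gap p by rewrite /moser_gap mulr_ge0 ?powR_ge0// ltW.
have const0 : 0 <= moser_const p N.
  apply: divr_ge0; last by rewrite subr_ge0 ltW.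
  apply: divr_ge0; last exact: ltW.
  by rewrite addr_ge0// mulr_ge0// addr_ge0.
apply: ltr_wpDl; last exact: expR_gt0.
by apply: mulr_ge0.
Qed.

(** * Admissible functions below the critical parameter *)

Section upper.
Variable m : R.
Hypotheses (m0 : 0 < m) (mmc : m < mc).
Let k := m / mc.

Let k0 : 0 < k. Proof. by rewrite divr_gt0 ?mu_crit_gt0. Qed.
Let k1 : k < 1. Proof. by rewrite ltr_pdivrMr ?mul1r ?mu_crit_gt0. Qed.
Let mE : m `^ (p - 1) = k `^ (p - 1) * (N `^ (p - 1) * Wa).
Proof.
rewrite -mcE -powRM ?(ltW k0) ?(ltW mu_crit_gt0)//.
by rewrite /k mulfVK// gt_eqF// mu_crit_gt0.
Qed.

(** [upper_core] for v = m^(1/q) |u|, with [g] the energy including its factor [omega];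
    [omega theta] cancels in the quotient. *)
Lemma moser_trudinger_ratio_le (u : R -> R) : X1p p (p - 1) theta u ->
  (exists2 r, 0 < r & u r != 0) -> (Lqnorm (p - 1) p (u^`()%classic) <= 1)%E ->
  (lambda_integral theta (fun r => phi p (m * `|u r| `^ q)) / (Lqnorm theta p u `^ p)
   <= (upper_const p theta * mc `^ (p - 1) / (1 - k `^ (p - 1)))%:E)%E.
Proof.
move=> [acu _ [mu_ ufin] [mu'_ _]] [r1 r10 ur1] energy.
pose e r : R := `|u^`()%classic r| `^ p * r `^ (p - 1).
have e0 r : (0 <= (e r)%:E)%E by rewrite lee_fin mulr_ge0 ?powR_ge0.
have me : measurable_fun (`]0, +oo[ : set R) (fun r => (e r)%:E).
  apply/measurable_EFinP; apply: measurable_funM; last exact: measurable_powR_on.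
  exact: measurable_norm_powR.
have E1 : (Wa%:E * \int[mu]_(r in `]0%R, +oo[) (e r)%:E <= 1)%E.
  rewrite -(Lqnorm_powR _ (ltW p1)) -[leRHS](poweR1r p).
  by apply: poweR_ler => //; [exact: ltW|exact: poweR_ge0].
have itv_pos r s : 0 < r -> `]r, s[%classic `<=` (`]0, +oo[%classic : set R).
  by move=> r0 x /=; rewrite !in_itv/= andbT => /andP[+ _]; exact: lt_trans.
pose I (r s : R) : \bar R := (\int[mu]_(x in `]r, s[) (e x)%:E)%E.
have I0 r s : (0 <= I r s)%E by apply: integral_ge0 => x _; exact: e0.
have Ile r s : 0 < r -> (I r s <= \int[mu]_(r in `]0%R, +oo[) (e r)%:E)%E.
  by move=> r0; apply: ge0_subset_integral => //; exact: itv_pos.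
(* Finiteness of the energy, so that [fine] loses nothing in [g]. *)
have Ilty : (\int[mu]_(r in `]0%R, +oo[) (e r)%:E < +oo)%E.
  have /le_lt_trans := E1; move=> /(_ _ (ltry 1)); apply: contraTT.
  by rewrite -!leNgt !leye_eq => /eqP ->; rewrite gt0_muley ?lte_fin.
have Ifin r s : 0 < r -> I r s \is a fin_num.
  by move=> r0; rewrite ge0_fin_numE// (le_lt_trans (Ile _ s r0)).
pose g r s := Wa * fine (I r s).
have g0 r s : 0 < r -> r <= s -> 0 <= g r s.
  by move=> r0 rs; rewrite mulr_ge0 ?fine_ge0// ltW.
have gD r s t : 0 < r -> r <= s -> s <= t -> g r s + g s t <= 1.
  move=> r0 rs st; have s0 : 0 < s by exact: lt_le_trans rs.
  rewrite /g -mulrDr -lee_fin EFinM EFinD !fineK ?Ifin//.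
  apply: le_trans E1; apply: lee_wpmul2l; first by rewrite lee_fin ltW.
  rewrite /I -ge0_integral_setU//.
  - apply: ge0_subset_integral => //; first exact: measurableU.
    by move=> x [|]; exact: itv_pos.
  - by apply: measurable_funS me => // x [|]; exact: itv_pos.
  - apply/disj_setPS => x [/=]; rewrite !in_itv/= => /andP[_ xs] /andP[sx _].
    by have := lt_trans xs sx; rewrite ltxx.
pose v r := m `^ q^-1 * `|u r|.
have qinv : q^-1 * p = p - 1 by rewrite /q invf_div mulfVK// gt_eqF.
have q0 : q != 0 by rewrite mulf_neq0 ?invr_neq0// gt_eqF.
have vqE r : v r `^ q = m * `|u r| `^ q.
  by rewrite /v powRM ?powR_ge0// -powRrM mulVf// powRr1// ltW.
have vpE r : v r `^ p = m `^ (p - 1) * `|u r| `^ p.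
  by rewrite /v powRM ?powR_ge0// -powRrM qinv.
have v0 r : 0 < r -> 0 <= v r by move=> _; rewrite mulr_ge0 ?powR_ge0.
have mv : measurable_fun (`]0, +oo[ : set R) v.
  by apply: measurable_funM => //; exact: measurableT_comp.
have vg r s : 0 < r -> r <= s ->
    `|v r - v s| `^ p <= k `^ (p - 1) * (g r s * (N * (ln s - ln r)) `^ (p - 1)).
  move=> r0 rs; have p_gt1 : 1 < p by move: p2; lra.
  have := increment_powR_le p_gt1 r0 rs acu mu'_.
  rewrite -/(I r s) -(fineK (Ifin r s r0)) -EFinM lee_fin => h.
  have lrs : 0 <= ln s - ln r by rewrite subr_ge0 ler_ln// posrE (lt_le_trans r0).
  have -> : k `^ (p - 1) * (g r s * (N * (ln s - ln r)) `^ (p - 1)) =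
      m `^ (p - 1) * (fine (I r s) * (ln s - ln r) `^ (p - 1)).
    by rewrite powRM ?(ltW N0)// /g mE; ring.
  rewrite /v -mulrBr normrM (ger0_norm (powR_ge0 _ _)) powRM ?powR_ge0// -powRrM qinv.
  apply: ler_wpM2l; first exact: powR_ge0.
  apply: le_trans h; apply: powR_le; [exact: ltW|exact: normr_ge0|].
  by rewrite (distrC (u s)); exact: ler_dist_dist.
set J := (\int[mu]_(r in `]0%R, +oo[) (`|u r| `^ p * r `^ theta)%:E)%E.
have J0 : (0 < J)%E by exact: mass_gt0 ur1.
have LqE : (Lqnorm theta p u `^ p = Wt%:E * J)%E by exact: Lqnorm_powR.
have Jfin : J \is a fin_num.
  rewrite ge0_fin_numE ?(ltW J0)//.
  have : (Lqnorm theta p u `^ p < +oo)%E by exact: poweR_lty.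
  rewrite LqE; apply: contraTT.
  by rewrite -!leNgt !leye_eq => /eqP ->; rewrite gt0_muley ?lte_fin.
have fJ0 : 0 < fine J by rewrite fine_gt0// J0 -ge0_fin_numE// ltW.
have vm : (\int[mu]_(r in `]0%R, +oo[) (v r `^ p * r `^ theta)%:E =
    (m `^ (p - 1) * fine J)%:E)%E.
  rewrite EFinM fineK// -ge0_integralZl_EFin ?powR_ge0//.
  - by apply: eq_integral => r _; rewrite vpE -EFinM mulrA.
  - by move=> r _; rewrite lee_fin mulr_ge0 ?powR_ge0.
  - apply/measurable_EFinP; apply: measurable_funM; last exact: measurable_powR_on.
    exact: measurable_norm_powR.
have M0 : 0 < m `^ (p - 1) * fine J by rewrite mulr_gt0// powR_gt0.
have core := upper_core p2 theta0 k0 k1 M0 v0 mv vm g0 gD vg.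
have k1' : 0 < 1 - k `^ (p - 1).
  have n1 : 1 \is @Num.nneg R by rewrite nnegrE.
  by have := gt0_ltr_powR p1 (ltW k0) n1 k1; rewrite powR1 subr_gt0.
rewrite /lambda_integral LqE -(fineK Jfin) -EFinM inver (gt_eqF (mulr_gt0 Wt0 fJ0)).
rewrite muleAC -EFinM.
have w0 : 0 <= Wt / (Wt * fine J) := divr_ge0 (ltW Wt0) (mulr_ge0 (ltW Wt0) (ltW fJ0)).
apply: (@le_trans _ _ ((Wt / (Wt * fine J))%:E *
    (upper_const p theta / (1 - k `^ (p - 1)) * (m `^ (p - 1) * fine J))%:E)%E).
  apply: lee_wpmul2l; first by rewrite lee_fin.
  apply: le_trans core; rewrite le_eqVlt; apply/orP; left; apply/eqP.
  by apply: eq_integral => r _; rewrite vqE.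
rewrite -EFinM lee_fin.
have -> : Wt / (Wt * fine J) *
      (upper_const p theta / (1 - k `^ (p - 1)) * (m `^ (p - 1) * fine J)) =
    upper_const p theta * m `^ (p - 1) / (1 - k `^ (p - 1)).
  by field; rewrite !gt_eqF.
apply: ler_wpM2r; first by rewrite invr_ge0 ltW.
apply: ler_wpM2l; first exact/ltW/upper_const_gt0.
(* Bounding [m] by [mc] frees the constant from [m]. *)
by apply: powR_le; exact: ltW.
Qed.

Lemma TMSC_le :
  (TMSC p m (p - 1) theta <=
   (upper_const p theta * mc `^ (p - 1) / (1 - k `^ (p - 1)))%:E)%E.
Proof.
apply: ge_ereal_sup => _ [u [Xu u0 eu] <-].
exact: moser_trudinger_ratio_le.
Qed.

End upper.
(** The gain e^(k L) on the plateau and its volume, of order e^(-L), multiply to a constant, while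
    the mass is of order 1 / L. Allowing every m >= k mc lets the critical parameter use all k < 1
    close to 1. *)
Lemma TMSC_ge : exists2 c, 0 < c & forall k m, 2^-1 <= k -> k < 1 -> k * mc <= m ->
  ((c / (1 - k))%:E <= TMSC p m (p - 1) theta)%E.
Proof.
have [C1 C10 HC1] := @expR_le_phi R p.
pose c1 := expR (- 1) / (C1 * 2 `^ N).
pose D0 := (2 * p) `^ p * (2 / N).
have c10 : 0 < c1 by rewrite divr_gt0 ?expR_gt0// mulr_gt0// powR_gt0.
have D00 : 0 < D0 by rewrite mulr_gt0 ?powR_gt0 ?divr_gt0// mulr_gt0.
have NW0 : 0 < N `^ (p - 1) * Wa by rewrite mulr_gt0 ?powR_gt0.
exists (c1 * (N `^ (p - 1) * Wa) / D0).
  by rewrite divr_gt0// mulr_gt0.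
move=> k m k2 k1 km.
pose L := (1 - k)^-1.
have k1' : 0 < 1 - k by rewrite subr_gt0.
have L0 : 0 < L by rewrite invr_gt0.
have kL : k * L = L - 1.
  by rewrite /L; field; rewrite gt_eqF.
(* Here k >= 1 / 2 enters: k L = L - 1 must be at least 1 for comparing [phi] with the
   exponential. *)
have L2 : 2 <= L.
  by rewrite /L -[leLHS]invrK lef_pV2 ?posrE ?invr_gt0//; lra.
(* The amplitude for which the energy is exactly 1. *)
pose A := (N `^ (p - 1) * Wa * L) `^ (- p^-1).
have NWL0 : 0 < N `^ (p - 1) * Wa * L by rewrite mulr_gt0.
have A0 : 0 < A by exact: powR_gt0.
have Ap : A `^ p = (N `^ (p - 1) * Wa * L)^-1.
  by rewrite /A -powRrM mulNr mulVf ?gt_eqF// powR_inv1// ltW.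
pose u := moser_fun theta A L.
have acu : locally_absolutely_continuous u by exact: moser_fun_locally_ac.
have mu_ : measurable_fun (`]0, +oo[ : set R) u by exact: measurable_moser_fun.
have mu'_ : measurable_fun (`]0, +oo[ : set R) (u^`()%classic).
  exact: measurable_derive_moser_fun.
have u0 r : 0 <= u r by apply: moser_fun_ge0.
set b := expR (- L / N).
have ub : u b != 0.
  by rewrite /u moser_fun_inner ?expR_gt0// gt_eqF// mulr_gt0.
have energy : (Lqnorm (p - 1) p (u^`()%classic) = 1)%E.
  have E : (Lqnorm (p - 1) p (u^`()%classic) `^ p = 1)%E.
    rewrite (Lqnorm_powR _ (ltW p1)) moser_fun_energy// -EFinM; congr (_%:E).
    rewrite Ap -/N -/Wa; field.
    by rewrite !gt_eqF// powR_gt0.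
  have : (Lqnorm (p - 1) p (u^`()%classic) = (Lqnorm (p - 1) p (u^`()%classic) `^ p) `^ p^-1)%E.
    by rewrite -poweRrM divff ?gt_eqF// poweRe1// poweR_ge0.
  by rewrite E poweR1r.
set J := (\int[mu]_(r in `]0%R, +oo[) (`|u r| `^ p * r `^ theta)%:E)%E.
have J0 : (0 < J)%E by apply: (mass_gt0 acu mu_ _ ub); exact: expR_gt0.
have LqE : (Lqnorm theta p u `^ p = Wt%:E * J)%E by exact: Lqnorm_powR.
have Jle : (J <= (A `^ p * D0)%:E)%E.
  apply: le_trans (moser_fun_mass p2 theta0 A0 L0); rewrite le_eqVlt; apply/orP; left; apply/eqP.
  by apply: eq_integral => r _; rewrite ger0_norm.
have Jfin : J \is a fin_num.
  by rewrite ge0_fin_numE ?(ltW J0)// (le_lt_trans Jle)// ltry.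
have fJ0 : 0 < fine J by rewrite fine_gt0// J0 -ge0_fin_numE// ltW.
have Xu : X1p p (p - 1) theta u.
  split => //; first exact: moser_fun_cvg0.
    split => //; apply: (@lty_poweRy _ _ p); first by rewrite gt_eqF.
    by rewrite LqE -(fineK Jfin) -EFinM ltry.
  by split => //; rewrite energy ltry.
apply: le_trans; last first.
  apply: ereal_sup_ubound; exists u; last reflexivity.
  by split => //; [exists b => //; exact: expR_gt0|rewrite energy].
rewrite /lambda_integral LqE -(fineK Jfin) -EFinM inver (gt_eqF (mulr_gt0 Wt0 fJ0)).
rewrite muleAC -EFinM.
have w0 : 0 <= Wt / (Wt * fine J) := divr_ge0 (ltW Wt0) (mulr_ge0 (ltW Wt0) (ltW fJ0)).
have m0 : 0 <= m.
  by apply: le_trans km; rewrite mulr_ge0 ?(ltW mu_crit_gt0)//; lra.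
(* On the plateau the critical exponent is exactly [L], so for m >= k mc the exponent is at least k
   L. *)
have ALq : mc * (A * L) `^ q = L.
  have root x : 0 <= x -> (x `^ (p - 1)) `^ (p - 1)^-1 = x.
    by move=> x0; rewrite -powRrM divff ?gt_eqF// powRr1.
  rewrite (powR_conjugateE p) -[in LHS](root mc (ltW mu_crit_gt0)) -powRM ?powR_ge0//.
  rewrite -[RHS](root _ (ltW L0)); congr (_ `^ _).
  rewrite powRM ?(ltW A0) ?(ltW L0)// Ap -(mulr_powRB1 (ltW L0) p0) mcE.
  by field; rewrite !gt_eqF// powR_gt0.
have phiL : ((expR (k * L))%:E <= C1%:E * phi p (m * (A * L) `^ q))%E.
  have kL1 : 1 <= k * L by rewrite kL; lra.
  apply: (le_trans (HC1 _ kL1)); apply: lee_wpmul2l; first by rewrite lee_fin ltW.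
  apply: phi_nondecreasing; first exact: le_trans kL1.
  rewrite -[in leLHS]ALq mulrA; apply: ler_wpM2r => //; exact: powR_ge0.
apply: (@le_trans _ _ ((Wt / (Wt * fine J))%:E * c1%:E)%E); last first.
  apply: lee_wpmul2l; first by rewrite lee_fin.
  rewrite (_ : (\int[mu]_(r in _) _)%E =
      (\int[mu]_(r in `]0%R, +oo[) (phi p (m * u r `^ q) * (r `^ theta)%:E))%E); last first.
    by apply: eq_integral => r _; rewrite ger0_norm.
  apply: le_trans (moser_fun_exp_integral p A theta0 L0 m0).
  have -> : c1 = C1^-1 * expR (k * L) * (expR (- L) / 2 `^ N).
    rewrite kL -[RHS]mulrA (mulrA (expR (L - 1))) -expRD addrAC subrr add0r /c1 invfM.
    by rewrite mulrCA mulrA.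
  rewrite EFinM; apply: lee_wpmul2r.
    by rewrite lee_fin divr_ge0 ?expR_ge0 ?powR_ge0.
  by rewrite EFinM lee_pdivrMl.
rewrite -EFinM lee_fin.
have fJle : fine J <= A `^ p * D0 by rewrite -lee_fin fineK.
have -> : Wt / (Wt * fine J) * c1 = c1 / fine J by field; rewrite !gt_eqF.
(* A^p is a constant times 1 / L = 1 - k, the source of the blow-up. *)
have -> : c1 * (N `^ (p - 1) * Wa) / D0 / (1 - k) = c1 / (A `^ p * D0).
  by rewrite Ap /L; field; rewrite !gt_eqF// powR_gt0.
apply: ler_wpM2l; first exact: ltW.
by rewrite lef_pV2 ?posrE// mulr_gt0// powR_gt0.
Qed.

End assembly.

Theorem theorem1p1 (R : realType) (p alpha theta : R) :
  2 <= p -> alpha = p - 1 -> 0 <= theta ->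
  (exists c C : R, [/\ 0 < c, 0 < C &
    \forall mu \near (mu_crit alpha theta)^'-,
      ((c / (1 - (mu / mu_crit alpha theta) `^ (p - 1)))%:E
         <= TMSC p mu alpha theta)%E /\
      (TMSC p mu alpha theta
         <= (C / (1 - (mu / mu_crit alpha theta) `^ (p - 1)))%:E)%E]) /\
  TMSC p (mu_crit alpha theta) alpha theta = +oo%E.
Proof.
move=> p2 -> theta0; set mc := mu_crit (p - 1) theta.
have mc0 : 0 < mc by exact: mu_crit_gt0.
have [c c0 lower] := TMSC_ge p2 theta0.
split; last first.
  (* For k = 1 - d the lower bound is c / d >= M, and d <= 1 / 2 keeps k >= 1 / 2. *)
  apply/eqyP => M M0; pose d := Num.min 2^-1 (c / M).
  have d0 : 0 < d by rewrite lt_min invr_gt0 ltr0n/= divr_gt0.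
  have d2 : d <= 2^-1 by rewrite ge_min lexx.
  have dM : d <= c / M by rewrite ge_min lexx orbT.
  apply: le_trans (lower (1 - d) mc _ _ _); [|lra|lra|].
    by rewrite lee_fin subKr ler_pdivlMr// mulrC -ler_pdivlMr.
  by rewrite ler_piMl ?(ltW mc0)//; lra.
exists c, (upper_const p theta * mc `^ (p - 1)); split => //.
  by rewrite mulr_gt0 ?powR_gt0// upper_const_gt0.
near=> m.
have mmc : m < mc by near: m; exact: nbhs_left_lt.
have m2 : mc / 2 < m.
  by near: m; apply: nbhs_left_gt; rewrite ltr_pdivrMr// ltr_pMr// ltr1n.
have m0 : 0 < m by apply: lt_trans m2; rewrite divr_gt0.
split; last exact: TMSC_le.
pose k := m / mc.
have k0 : 0 < k by rewrite divr_gt0.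
have k1 : k < 1 by rewrite ltr_pdivrMr ?mul1r.
have k2 : 2^-1 <= k by rewrite ler_pdivlMr// mulrC ltW.
apply: le_trans (lower k m k2 k1 _); last by rewrite mulfVK ?gt_eqF.
rewrite lee_fin; apply: ler_wpM2l; first exact: ltW.
(* As p >= 2, 1 - k is at most 1 - k^(p - 1), so the bound by c / (1 - k) is the stronger one. *)
have kp : k `^ (p - 1) <= k by apply: ge1r_powR; [rewrite k0 ltW|lra].
by rewrite lef_pV2 ?posrE; rewrite -/k; lra.
Unshelve. all: by end_near. Qed.
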